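(* Assume (SC). For the algorithm AGDA+, with either setting $\texttt{max\_solver}\in\{\texttt{True},\texttt{False}\}$, for every $t\in\mathbb N$ the backtracking condition $\mathrm{BC}(t)$ holds in finite time; that is, for each $t$ the condition $\mathrm{BC}(t)$ (step (2c)) is checked only finitely many times before it is satisfied. Hence AGDA+ is well defined for $\texttt{max\_solver}\in\{\texttt{True},\texttt{False}\}$.
   Context: Setting. $\mathcal X,\mathcal Y$ are finite-dimensional Euclidean spaces with Euclidean norm $\|\cdot\|$; $\mathbb N=\{0,1,2,\dots\}$, $\mathbb N_+=\mathbb N\setminus\{0\}$. Problem: $\min_{x\in\mathcal X}\max_{y\in\mathcal Y}\mathcal L(x,y)$ with $\mathcal L(x,y)=g(x)+f(x,y)-h(y)$. Assumption (SC): $g:\mathcal X\to\mathbb R\cup\{+\infty\}$ and $h:\mathcal Y\to\mathbb R\cup\{+\infty\}$ are proper closed convex; $f:\mathcal X\times\mathcal Y\to\mathbb R$ is differentiable on an open set containing $\mathrm{dom}\,g\times\mathrm{dom}\,h$; $\nabla f$ is $L$-Lipschitz on $\mathrm{dom}\,g\times\mathrm{dom}\,h$; and $f(x,\cdot)$ is strongly concave with modulus $\mu>0$ for every $x\in\mathrm{dom}\,g$. Notation: $\mathbf{prox}_{r}(x)=\arg\min_w\{r(w)+\frac12\|w-x\|^2\}$; $G_x^\tau(x,y)=[x-\mathbf{prox}_{\tau g}(x-\tau\nabla_xf(x,y))]/\tau$; $G_y^\sigma(x,y)=[\mathbf{prox}_{\sigma h}(y+\sigma\nabla_yf(x,y))-y]/\sigma$.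 $\mathcal D_y=\sup_{y_1,y_2\in\mathrm{dom}\,h}\|y_1-y_2\|$. Algorithm AGDA+. Inputs: $(x_0,y_0)\in\mathrm{dom}\,g\times\mathrm{dom}\,h$; $\zeta,\tilde\mu,\tilde l>0$ with $\tilde l>\tilde\mu$; $\gamma_0,\gamma\in(0,1)$; $r\in\mathbb N_+$; a Boolean $\texttt{max\_solver}$. Put $\gamma_1=\gamma^r$, $\gamma_2=\gamma$. If $\mu$ is known, $\underline\mu=\tilde\mu=\mu$; otherwise $\underline\mu=0$. $\bar{\mathcal D}_y=\mathcal D_y$ if $\mathcal D_y<\infty$ is known, otherwise $\bar{\mathcal D}_y=+\infty$. Initialize $l_0=L_0=\tilde l$, $\mu_0=\tilde\mu$, $t=0$, $l_0^\circ=l_0$, $\texttt{flag}=\texttt{False}$. Repeat: (1) If $\texttt{max\_solver}=\texttt{True}$ and $\texttt{flag}=\texttt{False}$, replace $y_t$ by a point satisfying $\mathcal L(x_t,y_t)+\zeta\ge\max_{y}\mathcal L(x_t,y)$. If $\texttt{max\_solver}=\texttt{False}$, set $\hat y_t=\mathbf{prox}_{h/L_t}(y_t+\frac1{L_t}\nabla_yf(x_t,y_t))$, $d_t=\|\hat y_t-y_t\|$, then $y_t\leftarrow\hat y_t$. Set $\texttt{flag}\leftarrow\texttt{True}$. (2) While $l_t\le L_t$: (2a) $\sigma_t=1/l_t$, $\tau_t=\frac{1-\gamma_0}{l_t}\Big(4+\frac1{\gamma_2}+\frac{4(1-\sigma_t\mu_t)(2-\sigma_t\mu_t)(15L_t-8\mu_t)L_t^3}{\mu_t^4}\Big)^{-1}$,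 $\tilde x_{t+1}=\mathbf{prox}_{\tau_tg}(x_t-\tau_t\nabla_xf(x_t,y_t))$, $\tilde y_{t+1}=\mathbf{prox}_{\sigma_th}(y_t+\sigma_t\nabla_yf(\tilde x_{t+1},y_t))$. (2b) If $\texttt{flag}=\texttt{True}$: set $R_t=0$ and, if $\texttt{max\_solver}=\texttt{True}$, $\Delta_t=\frac{2\zeta}{\mu_t}$, $\Lambda_t=\zeta+\sqrt{2\zeta/\mu_t}\,L_t\|y_t-\tilde y_{t+1}\|$; if $\texttt{max\_solver}=\texttt{False}$, $\Delta_t=\min\{(1+\frac{2L_t}{\mu_t})^2d_t^2,\bar{\mathcal D}_y^2\}$, $\Lambda_t=2d_tL_t\|y_t-\tilde y_{t+1}\|$. (2c) Check $\mathrm{BC}(t)$. If it holds: $x_{t+1}=\tilde x_{t+1}$, $y_{t+1}=\tilde y_{t+1}$, $l_{t+1}=l_{t+1}^\circ=\max\{\gamma_2l_t,\tilde l\}$, $L_{t+1}=L_t$, $\mu_{t+1}=\mu_t$, $C_t=\frac{(1-\sigma_t\mu_t)(2-\sigma_t\mu_t)}{\sigma_t\mu_t}\frac{L_t^2}{\mu_t^2}\tau_t^2$, $\Delta_{t+1}=(1-\mu_t\sigma_t/2)\Delta_t+C_t\|G_x^{\tau_t}(x_t,y_t)\|^2$, $\Lambda_{t+1}=6l_t(\Delta_{t+1}+2\Delta_t)-8\mu_t\Delta_t$, $R_{t+1}=2\tau_t^2l_t\|G_x^{\tau_t}(x_t,y_t)\|^2-\sigma_t^2\mu_t\|G_y^{\sigma_t}(x_{t+1},y_t)\|^2$,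 then $t\leftarrow t+1$, $\texttt{flag}\leftarrow\texttt{False}$. If it fails: $l_t\leftarrow l_t/\gamma_2$. (3) (when $l_t>L_t$) $L_t\leftarrow L_t/\gamma_1$, $\mu_t\leftarrow\max\{\mu_t\gamma_1,\underline\mu\}$, return to (1). Backtracking condition $\mathrm{BC}(t)$: all four of (i) $(\tau_t-(2+\frac1\gamma)\tau_t^2l_t)\|G_x^{\tau_t}(x_t,y_t)\|^2+\sigma_t\|G_y^{\sigma_t}(x_t,y_t)\|^2+\sigma_t^2\frac{\mu_t}2\|G_y^{\sigma_t}(\tilde x_{t+1},y_t)\|^2\le\Lambda_t+4(3l_t-2\mu_t)\Delta_t+\mathcal L(x_t,y_t)-\mathcal L(\tilde x_{t+1},\tilde y_{t+1})+R_t$; (ii) $f(\tilde x_{t+1},y_t)+\langle\nabla_yf(\tilde x_{t+1},y_t),\tilde y_{t+1}-y_t\rangle\le f(\tilde x_{t+1},\tilde y_{t+1})+\frac{l_t}2\|\tilde y_{t+1}-y_t\|^2$; (iii) $\|\nabla_yf(\tilde x_{t+1},\tilde y_{t+1})-\nabla_yf(\tilde x_{t+1},y_t)\|\le l_t\|\tilde y_{t+1}-y_t\|$; (iv) $\|G_y^{\sigma_t}(\tilde x_{t+1},y_t)\|^2\le2\big(\frac{4(1-\sigma_t\mu_t)}{\sigma_t^2}+2l_t^2\big)\Delta_t+2l_t^2\tau_t^2\|G_x^{\tau_t}(x_t,y_t)\|^2$. *)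

(* Defs.v *)
From HB Require Import structures.
From mathcomp Require Import all_boot all_order all_algebra.
From mathcomp Require Import all_classical all_reals all_analysis.

Set Implicit Arguments.
Unset Strict Implicit.
Unset Printing Implicit Defensive.

Import Order.TTheory GRing.Theory Num.Theory.
Import numFieldNormedType.Exports.

Local Open Scope classical_set_scope.
Local Open Scope ring_scope.

(* Euclidean spaces are the row spaces 'rV[R]_n. The norm that the library
   puts on 'rV[R]_n is the sup norm: it is used only for topology and
   differentiability, never for the quantities of the algorithm. *)
Section euclidean.
Context {R : realType}.

Definition dotv (n : nat) (u v : 'rV[R]_n) : R := \sum_(i < n) u 0 i * v 0 i.

Definition norm2 (n : nat) (u : 'rV[R]_n) : R := Num.sqrt (dotv u u).

End euclidean.

Section convex_analysis.
Context {R : realType}.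

Definition edom (n : nat) (r : 'rV[R]_n -> \bar R) : set 'rV[R]_n :=
  [set x | (r x < +oo)%E].

Definition proper_fun (n : nat) (r : 'rV[R]_n -> \bar R) : Prop :=
  (forall x, r x != -oo%E) /\ edom r !=set0.

Definition econvex (n : nat) (r : 'rV[R]_n -> \bar R) : Prop :=
  forall (x y : 'rV[R]_n) (a : R), 0 <= a <= 1 ->
    (r (a *: x + (1 - a) *: y)%R <= a%:E * r x + (1 - a)%:E * r y)%E.

Definition proper_closed_convex (n : nat) (r : 'rV[R]_n -> \bar R) : Prop :=
  [/\ proper_fun r, lower_semicontinuous r & econvex r].

Definition strongly_concave (n : nat) (mu : R) (phi : 'rV[R]_n -> R) : Prop :=
  forall (x y : 'rV[R]_n) (a : R), 0 <= a <= 1 ->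
    a * phi x + (1 - a) * phi y + mu / 2 * a * (1 - a) * norm2 (x - y) ^+ 2
      <= phi (a *: x + (1 - a) *: y).

Definition is_prox (n : nat) (r : 'rV[R]_n -> \bar R) (x p : 'rV[R]_n) : Prop :=
  forall w, (r p + (norm2 (p - x) ^+ 2 / 2)%:E
             <= r w + (norm2 (w - x) ^+ 2 / 2)%:E)%E.

(* The argmin, as a choice of a minimizer; it exists and is unique when [r] is
   proper closed convex, and the value is the junk 0 when there is none. *)
Definition prox (n : nat) (r : 'rV[R]_n -> \bar R) (x : 'rV[R]_n) : 'rV[R]_n :=
  xget 0 [set p | is_prox r x p].

Definition escale (n : nat) (c : R) (r : 'rV[R]_n -> \bar R) : 'rV[R]_n -> \bar R :=
  fun x => (c%:E * r x)%E.

Definition diameter (n : nat) (D : set 'rV[R]_n) : \bar R :=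
  ereal_sup [set e | exists y1 y2, [/\ D y1, D y2 & e = (norm2 (y1 - y2))%:E]].

End convex_analysis.

Section problem.
Context {R : realType} {m n : nat}.
Variables (g : 'rV[R]_m -> \bar R) (h : 'rV[R]_n -> \bar R).
Variable f : 'rV[R]_m -> 'rV[R]_n -> R.

Definition fpair (z : 'rV[R]_m * 'rV[R]_n) : R := f z.1 z.2.

Definition gradx (x : 'rV[R]_m) (y : 'rV[R]_n) : 'rV[R]_m :=
  \row_i 'D_(delta_mx 0 i, 0) fpair (x, y).

Definition grady (x : 'rV[R]_m) (y : 'rV[R]_n) : 'rV[R]_n :=
  \row_j 'D_(0, delta_mx 0 j) fpair (x, y).

(* The extended-real subtraction is meaningful for x in dom g or y in dom h. *)
Definition Lag (x : 'rV[R]_m) (y : 'rV[R]_n) : \bar R :=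
  (g x + (f x y)%:E - h y)%E.

Definition Gx (tau : R) (x : 'rV[R]_m) (y : 'rV[R]_n) : 'rV[R]_m :=
  tau^-1 *: (x - prox (escale tau g) (x - tau *: gradx x y)).

Definition Gy (sigma : R) (x : 'rV[R]_m) (y : 'rV[R]_n) : 'rV[R]_n :=
  sigma^-1 *: (prox (escale sigma h) (y + sigma *: grady x y) - y).

Definition pair_norm2 (u : 'rV[R]_m) (v : 'rV[R]_n) : R :=
  Num.sqrt (norm2 u ^+ 2 + norm2 v ^+ 2).

Definition assumption_SC (Lf mu : R) : Prop :=
  [/\ proper_closed_convex g /\ proper_closed_convex h,
      exists U : set ('rV[R]_m * 'rV[R]_n),
        [/\ open U, edom g `*` edom h `<=` U
          & forall z, U z -> differentiable fpair z],
      0 <= Lf /\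
      (forall x x' y y', edom g x -> edom g x' -> edom h y -> edom h y' ->
        pair_norm2 (gradx x y - gradx x' y') (grady x y - grady x' y')
          <= Lf * pair_norm2 (x - x') (y - y'))
    & 0 < mu /\ (forall x, edom g x -> strongly_concave mu (f x))].

End problem.

Record agda_inputs (R : realType) := AgdaInputs {
  zeta : R;
  mu_init : R;
  l_init : R;
  gamma0 : R;
  gamma : R;
  rexp : nat;
  max_solver : bool;
  mu_known : bool;
  Dy_known : bool
}.

Definition valid_inputs (R : realType) (mu : R) (P : agda_inputs R) : Prop :=
  [/\ [/\ 0 < zeta P, 0 < mu_init P & mu_init P < l_init P],
      0 < gamma0 P < 1, 0 < gamma P < 1, (0 < rexp P)%N
    & mu_known P -> mu_init P = mu].

(* Program counter: [Outer] is the head of the outer loop, where y_t is solved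
   for or moved by a proximal step; [Inner] is the test l_t <= L_t of the while
   loop. *)
Inductive phase := Outer | Inner.

(* The current values of the variables with index [it]. The step sizes and the
   trial points are not stored: they are functions of the state. *)
Record agda_state (R : realType) (m n : nat) := AgdaState {
  ph : phase;
  it : nat;
  xs : 'rV[R]_m;
  ys : 'rV[R]_n;
  ls : R;
  lcirc : R;
  Ls : R;
  mus : R;
  flag : bool;
  ds : R;
  Deltas : R;
  Lambdas : R;
  Rs : R
}.

Section algorithm.
Context {R : realType} {m n : nat}.
Variables (g : 'rV[R]_m -> \bar R) (h : 'rV[R]_n -> \bar R).
Variable f : 'rV[R]_m -> 'rV[R]_n -> R.
Variables (mu : R) (P : agda_inputs R).

Local Notation state := (agda_state R m n).
Implicit Types s : state.

Definition gamma1 : R := gamma P ^+ rexp P.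
Definition gamma2 : R := gamma P.
Definition mu_low : R := if mu_known P then mu else 0.
Definition Dy_bar : \bar R := if Dy_known P then diameter (edom h) else +oo%E.

(* The fields that are not constrained here are not initialized by the
   algorithm; they are written before they are read. *)
Definition initial (x0 : 'rV[R]_m) (y0 : 'rV[R]_n) s : Prop :=
  [/\ ph s = Outer, it s = 0%N, xs s = x0 /\ ys s = y0,
      [/\ ls s = l_init P, lcirc s = l_init P, Ls s = l_init P
        & mus s = mu_init P]
    & flag s = false].

Definition enter_inner (y : 'rV[R]_n) (d : R) s : state := {|
  ph := Inner; it := it s; xs := xs s; ys := y;
  ls := ls s; lcirc := lcirc s; Ls := Ls s; mus := mus s; flag := true;
  ds := d; Deltas := Deltas s; Lambdas := Lambdas s; Rs := Rs s |}.

Definition max_approx s (y : 'rV[R]_n) : Prop :=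
  forall w, (Lag g h f (xs s) w <= Lag g h f (xs s) y + (zeta P)%:E)%E.

Definition yhat s : 'rV[R]_n :=
  prox (escale (Ls s)^-1 h) (ys s + (Ls s)^-1 *: grady f (xs s) (ys s)).

Definition sigmat s : R := (ls s)^-1.

Definition taut s : R :=
  (1 - gamma0 P) / ls s *
  (4 + 1 / gamma2
   + 4 * (1 - sigmat s * mus s) * (2 - sigmat s * mus s)
       * (15 * Ls s - 8 * mus s) * Ls s ^+ 3 / mus s ^+ 4)^-1.

Definition xtilde s : 'rV[R]_m :=
  prox (escale (taut s) g) (xs s - taut s *: gradx f (xs s) (ys s)).

Definition ytilde s : 'rV[R]_n :=
  prox (escale (sigmat s) h) (ys s + sigmat s *: grady f (xtilde s) (ys s)).

Definition Delta_fresh s : R :=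
  if max_solver P then 2 * zeta P / mus s
  else fine (Order.min (((1 + 2 * Ls s / mus s) ^+ 2 * ds s ^+ 2)%:E)
                       (Dy_bar ^+ 2)%E).

Definition Lambda_fresh s : R :=
  if max_solver P
  then zeta P + Num.sqrt (2 * zeta P / mus s) * Ls s * norm2 (ys s - ytilde s)
  else 2 * ds s * Ls s * norm2 (ys s - ytilde s).

Definition refresh s : state := if flag s then {|
    ph := ph s; it := it s; xs := xs s; ys := ys s;
    ls := ls s; lcirc := lcirc s; Ls := Ls s; mus := mus s; flag := flag s;
    ds := ds s; Deltas := Delta_fresh s; Lambdas := Lambda_fresh s; Rs := 0 |}
  else s.

Definition sq_Gx s : R := norm2 (Gx g f (taut s) (xs s) (ys s)) ^+ 2.

Definition sq_Gy_tilde s : R :=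
  norm2 (Gy h f (sigmat s) (xtilde s) (ys s)) ^+ 2.

Definition BC1 s : bool :=
  (((taut s - (2 + 1 / gamma P) * taut s ^+ 2 * ls s) * sq_Gx s
    + sigmat s * norm2 (Gy h f (sigmat s) (xs s) (ys s)) ^+ 2
    + sigmat s ^+ 2 * (mus s / 2) * sq_Gy_tilde s)%:E
   <= (Lambdas s + 4 * (3 * ls s - 2 * mus s) * Deltas s)%:E
      + Lag g h f (xs s) (ys s) - Lag g h f (xtilde s) (ytilde s)
      + (Rs s)%:E)%E.

Definition BC2 s : bool :=
  f (xtilde s) (ys s)
    + dotv (grady f (xtilde s) (ys s)) (ytilde s - ys s)
  <= f (xtilde s) (ytilde s) + ls s / 2 * norm2 (ytilde s - ys s) ^+ 2.

Definition BC3 s : bool :=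
  norm2 (grady f (xtilde s) (ytilde s) - grady f (xtilde s) (ys s))
  <= ls s * norm2 (ytilde s - ys s).

Definition BC4 s : bool :=
  sq_Gy_tilde s
  <= 2 * (4 * (1 - sigmat s * mus s) / sigmat s ^+ 2 + 2 * ls s ^+ 2)
       * Deltas s
     + 2 * ls s ^+ 2 * taut s ^+ 2 * sq_Gx s.

Definition BC s : bool := [&& BC1 s, BC2 s, BC3 s & BC4 s].

Definition Ct s : R :=
  (1 - sigmat s * mus s) * (2 - sigmat s * mus s) / (sigmat s * mus s)
  * (Ls s ^+ 2 / mus s ^+ 2) * taut s ^+ 2.

Definition Delta_next s : R :=
  (1 - mus s * sigmat s / 2) * Deltas s + Ct s * sq_Gx s.

Definition accept s : state := {|
  ph := Inner; it := (it s).+1; xs := xtilde s; ys := ytilde s;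
  ls := Num.max (gamma2 * ls s) (l_init P);
  lcirc := Num.max (gamma2 * ls s) (l_init P);
  Ls := Ls s; mus := mus s; flag := false; ds := ds s;
  Deltas := Delta_next s;
  Lambdas := 6 * ls s * (Delta_next s + 2 * Deltas s) - 8 * mus s * Deltas s;
  Rs := 2 * taut s ^+ 2 * ls s * sq_Gx s
        - sigmat s ^+ 2 * mus s * sq_Gy_tilde s |}.

Definition reject s : state := {|
  ph := Inner; it := it s; xs := xs s; ys := ys s;
  ls := ls s / gamma2; lcirc := lcirc s; Ls := Ls s; mus := mus s;
  flag := flag s; ds := ds s;
  Deltas := Deltas s; Lambdas := Lambdas s; Rs := Rs s |}.

Definition enlarge s : state := {|
  ph := Outer; it := it s; xs := xs s; ys := ys s;
  ls := ls s; lcirc := lcirc s; Ls := Ls s / gamma1;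
  mus := Num.max (mus s * gamma1) mu_low;
  flag := flag s; ds := ds s;
  Deltas := Deltas s; Lambdas := Lambdas s; Rs := Rs s |}.

(* BC(it s) is evaluated once at each state that passes the while test. *)
Definition checks s : Prop := ph s = Inner /\ ls s <= Ls s.

(* Delta, Lambda and R are recomputed before each check while the flag is on. *)
Definition check_succeeds s : bool := BC (refresh s).

(* Nondeterministic only in [step_solve], where any approximate maximizer may
   be returned. *)
Inductive step : state -> state -> Prop :=
| step_solve s y of ph s = Outer & max_solver P & ~~ flag s & max_approx s y :
    step s (enter_inner y (ds s) s)
| step_keep s of ph s = Outer & max_solver P & flag s :
    step s (enter_inner (ys s) (ds s) s)
| step_prox s of ph s = Outer & ~~ max_solver P :
    step s (enter_inner (yhat s) (norm2 (yhat s - ys s)) s)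
| step_accept s of checks s & check_succeeds s :
    step s (accept (refresh s))
| step_reject s of checks s & ~~ check_succeeds s :
    step s (reject (refresh s))
| step_enlarge s of ph s = Inner & Ls s < ls s :
    step s (enlarge s).

Definition partial_run x0 y0 (N : nat) (u : nat -> state) : Prop :=
  initial x0 y0 (u 0%N) /\ forall k, (k < N)%N -> step (u k) (u k.+1).

Definition run x0 y0 (u : nat -> state) : Prop :=
  initial x0 y0 (u 0%N) /\ forall k, step (u k) (u k.+1).

End algorithm.

(* Main.v *)
Require Import Defs.
From HB Require Import structures.
From mathcomp Require Import all_boot all_order all_algebra.
From mathcomp Require Import all_classical all_reals all_analysis.
From mathcomp Require Import ring lra.
Import Order.TTheory GRing.Theory Num.Theory.
Import numFieldNormedType.Exports.
Local Open Scope classical_set_scope.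
Local Open Scope ring_scope.

Set Implicit Arguments.
Unset Strict Implicit.
Unset Printing Implicit Defensive.

(** When the flag is on, [y_t] is a [zeta]-maximizer of [L (x_t, .)], or a
    proximal step away from some earlier point, and [Delta_t] dominates the
    squared distance from [y_t] to the maximizer of [L (x_t, .)]: by quadratic
    growth in the first mode, and in the second because, for large [L_t], the
    proximal gradient map contracts towards that maximizer. Let [a] and [b] be
    the lengths of the trial steps in [x] and [y], and [e] the length of the step
    in [y] computed at [x_t] instead of at the new point: then
    [e ^ 2 <= 4 Delta_t] and [b <= a + e], so every error term of the
    backtracking condition is absorbed by [l_t Delta_t] and [l_t a ^ 2] as soon as
    [mu_t <= mu], [2 mu + 2 Lf <= l_t] and [Lf ^ 2 <= mu l_t]. The step size
    [tau_t] enters only through its positivity.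

    If the condition failed forever, [l_t] would tend to infinity, hence so would
    [L_t >= gamma l_t]. So [L_t] is enlarged at least once, which turns the flag
    on for good, and [mu_t <= mu] eventually holds because [mu_t L_t] is constant
    when [mu] is unknown; the condition then has to hold. *)

(** * Euclidean norm and minimizers on compact sets *)

Section euclidean_theory.
Context {R : realType} {n : nat}.
Implicit Types (u v w : 'rV[R]_n) (a : R).

Lemma dotvC u v : dotv u v = dotv v u.
Proof. by apply: eq_bigr => i _; rewrite mulrC. Qed.

Lemma dotvDl u v w : dotv (u + v) w = dotv u w + dotv v w.
Proof. by rewrite -big_split; apply: eq_bigr => i _; rewrite mxE mulrDl. Qed.

Lemma dotvZl a u v : dotv (a *: u) v = a * dotv u v.
Proof. by rewrite [RHS]mulr_sumr; apply: eq_bigr => i _; rewrite mxE mulrA. Qed.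

Lemma dotvNl u v : dotv (- u) v = - dotv u v.
Proof. by rewrite -scaleN1r dotvZl mulN1r. Qed.

Lemma dotvDr u v w : dotv u (v + w) = dotv u v + dotv u w.
Proof. by rewrite dotvC dotvDl !(dotvC u). Qed.

Lemma dotvZr a u v : dotv u (a *: v) = a * dotv u v.
Proof. by rewrite dotvC dotvZl dotvC. Qed.

Lemma dotvNr u v : dotv u (- v) = - dotv u v.
Proof. by rewrite dotvC dotvNl dotvC. Qed.

Lemma dotv0 u : dotv u 0 = 0.
Proof. by rewrite -(scale0r 0) dotvZr mul0r. Qed.

Definition dotvE := (dotvDl, dotvDr, dotvNl, dotvNr, dotvZl, dotvZr).

Lemma dotvv_ge0 u : 0 <= dotv u u.
Proof. by apply: sumr_ge0 => i _; rewrite -expr2 sqr_ge0. Qed.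

Lemma norm2_ge0 u : 0 <= norm2 u.
Proof. exact: sqrtr_ge0. Qed.

Lemma sqr_norm2 u : norm2 u ^+ 2 = dotv u u.
Proof. by rewrite sqr_sqrtr// dotvv_ge0. Qed.

Lemma sqr_norm2D u v :
  norm2 (u + v) ^+ 2 = norm2 u ^+ 2 + 2 * dotv u v + norm2 v ^+ 2.
Proof. by rewrite !sqr_norm2 !dotvE (dotvC v u); ring. Qed.

Lemma norm2N u : norm2 (- u) = norm2 u.
Proof. by rewrite /norm2 !dotvE opprK. Qed.

Lemma sqr_norm2B u v :
  norm2 (u - v) ^+ 2 = norm2 u ^+ 2 - 2 * dotv u v + norm2 v ^+ 2.
Proof. by rewrite sqr_norm2D dotvNr norm2N mulrN. Qed.

Lemma norm2B u v : norm2 (u - v) = norm2 (v - u).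
Proof. by rewrite -norm2N opprB. Qed.

Lemma norm2_0 : norm2 (0 : 'rV[R]_n) = 0.
Proof. by rewrite /norm2 dotv0 sqrtr0. Qed.

Lemma norm2Z a u : norm2 (a *: u) = `|a| * norm2 u.
Proof.
by rewrite /norm2 !dotvE mulrA -expr2 sqrtrM ?sqr_ge0// sqrtr_sqr.
Qed.

(** With [a = norm2 u], [b = norm2 v], expanding the square of [b u - a v] gives
    [2 a b (a b - dotv u v) >= 0], which settles the case [a b > 0]. *)
Lemma cauchy_schwarz u v : dotv u v <= norm2 u * norm2 v.
Proof.
have := dotvv_ge0 (norm2 v *: u - norm2 u *: v).
rewrite !dotvE (dotvC v u) -!sqr_norm2.
have := norm2_ge0 u; have := norm2_ge0 v.
set a := norm2 u; set b := norm2 v; set c := dotv u v => b0 a0 H.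
have [ab0|ab0] := ltP 0 (a * b); first by rewrite -(ler_pM2l ab0); nra.
have H0 : a * b = 0 by apply/eqP; rewrite eq_le ab0 mulr_ge0.
(* If [a = 0], the square of [(b ^ 2 + 1) u - c v] expands to [- (b ^ 2 + 2) c ^ 2], so
   nonnegativity forces [c = 0]; the case [b = 0] is symmetric. *)
have [a00|b00] : a = 0 \/ b = 0.
  by move/eqP: H0; rewrite mulf_eq0 => /orP[] /eqP; [left|right].
- have : dotv (u - c *: u) (u - c *: u) >= 0 by exact: dotvv_ge0.
  have := dotvv_ge0 (c *: u - v); have := dotvv_ge0 ((b ^+ 2 + 1) *: u - c *: v).
  have aa : dotv u u = 0 by rewrite -sqr_norm2 -/a a00 expr0n.
  rewrite !dotvE (dotvC v u) aa -[dotv v v]sqr_norm2 -/b -/c H0.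
  by nra.
- have := dotvv_ge0 ((a ^+ 2 + 1) *: v - c *: u).
  have bb : dotv v v = 0 by rewrite -sqr_norm2 -/b b00 expr0n.
  rewrite !dotvE (dotvC v u) bb -[dotv u u]sqr_norm2 -/a -/c H0.
  by nra.
Qed.

Lemma ler_norm2D u v : norm2 (u + v) <= norm2 u + norm2 v.
Proof.
rewrite -(@ler_pXn2r _ 2) ?nnegrE ?addr_ge0 ?norm2_ge0//.
by rewrite sqr_norm2D; have := cauchy_schwarz u v; nra.
Qed.

Lemma norm2_triangle u v w : norm2 (u - w) <= norm2 (u - v) + norm2 (v - w).
Proof. by apply: le_trans (ler_norm2D _ _); rewrite addrA subrK. Qed.

(** Compactness is phrased with the sup norm and growth estimates with the Euclidean one; leaving a
    large sup-norm ball therefore means being far in the Euclidean sense. *)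
Lemma ler_norm_norm2 u : `|u| <= norm2 u.
Proof.
rewrite [leLHS]/Num.norm /= mx_normrE; apply: bigmax_le => [|[i j] _ /=].
  exact: norm2_ge0.
rewrite (ord1 i) -sqrtr_sqr ler_sqrt ?dotvv_ge0//.
rewrite /dotv (bigD1 j)//= -expr2 lerDl.
by apply: sumr_ge0 => k _; rewrite -expr2 sqr_ge0.
Qed.

Lemma dotv_continuous u : continuous (dotv u).
Proof.
rewrite /dotv; apply: continuous_big => [|i _ x].
  exact: add_continuous.
by apply: continuousM; [exact: cst_continuous|exact: coord_continuous].
Qed.

Lemma sqr_norm2B_continuous u : continuous (fun v => norm2 (v - u) ^+ 2).
Proof.
move=> x; rewrite (_ : (fun v => _) =
  fun v => \sum_(i < n) (v 0 i - u 0 i) * (v 0 i - u 0 i)); last first.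
  by apply/funext => v; rewrite sqr_norm2; apply: eq_bigr => i _; rewrite !mxE.
move: x; apply: continuous_big => [|i _ x]; first exact: add_continuous.
have c : {for x, continuous (fun v : 'rV[R]_n => v 0 i - u 0 i)}.
  by apply: continuousB; [exact: coord_continuous|exact: cst_continuous].
exact: (cvgM c c).
Qed.

End euclidean_theory.

Section minimizers.
Context {R : realType}.

(* The sublevel sets of [F] through points of [K] form a filter base on [K];
   a cluster point of that filter minimizes [F]. *)
Lemma lsc_min_compact (T : topologicalType) (K : set T) (F : T -> \bar R) :
  compact K -> K !=set0 -> lower_semicontinuous F -> (forall x, F x != -oo%E) ->
  exists2 p, K p & forall v, K v -> (F p <= F v)%E.
Proof.
move=> cK [k0 Kk0] lF noo.
pose B v := [set w | K w /\ (F w <= F v)%E].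
pose G : set_system T := [set A | exists2 v, K v & B v `<=` A].
have PG : ProperFilter G.
  split; first by move=> [v Kv] /(_ v); apply; split.
  split; first by exists k0.
    move=> A A' [v Kv vA] [v' Kv' vA'].
    have [vv'|/ltW vv'] := leP (F v) (F v').
      exists v => // w [Kw wv]; split; first exact: vA.
      by apply: vA'; split => //; exact: le_trans vv'.
    exists v' => // w [Kw wv]; split; last exact: vA'.
    by apply: vA; split => //; exact: le_trans vv'.
  by move=> A A' AA' [v Kv vA]; exists v => // w /vA /AA'.
have [|p [Kp cp]] := cK G PG; first by exists k0 => // w [].
exists p => // v Kv; rewrite leNgt; apply/negP => vp.
have Fv : F v = (fine (F v))%:E.
  by rewrite fineK// fin_numE noo/= lt_eqF// (lt_le_trans vp)// leey.
move: (vp); rewrite Fv => /lF [V nV VF].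
have [|w [[Kw wv] Vw]] := cp (B v) V _ nV; first by exists v.
by have := VF _ Vw; rewrite -Fv ltNge wv.
Qed.

End minimizers.

(** * Proximal maps *)

Section proximal.
Context {R : realType} {n : nat}.
Implicit Types (r : 'rV[R]_n -> \bar R) (u x w p q : 'rV[R]_n).

(** A substitute for the limit [a -> 0]: if [A < 0], the explicit value
    [a = - A / (- A + 2 |B| + 1)] already makes the expression negative. *)
Lemma ge0_affine_near0 (A B : R) :
  (forall a, 0 < a <= 1 -> 0 <= A + a * B) -> 0 <= A.
Proof.
move=> H; rewrite leNgt; apply/negP => A0.
have B0 := normr_ge0 B.
have d0 : 0 < - A + 2 * `|B| + 1 by lra.
have /H : 0 < - A / (- A + 2 * `|B| + 1) <= 1.
  by rewrite divr_gt0 ?oppr_gt0// ler_pdivrMr// mul1r; lra.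
apply/negP; rewrite -ltNge -(ltr_pM2r d0) mul0r mulrDl mulrAC divfK ?gt_eqF//.
have := ler_norm B; nra.
Qed.

Lemma fin_edom r x : (forall x, r x != -oo%E) -> edom r x ->
  r x = (fine (r x))%:E.
Proof. by move=> noo xd; rewrite fineK// fin_numE noo/= lt_eqF. Qed.

Lemma notin_edom r x : ~ edom r x -> r x = +oo%E.
Proof. by move=> /negP; rewrite -leNgt leye_eq => /eqP. Qed.

Lemma econvex_fine r x w (a : R) :
  (forall x, r x != -oo%E) -> econvex r -> edom r x -> edom r w -> 0 <= a <= 1 ->
  edom r (a *: x + (1 - a) *: w) /\
  fine (r (a *: x + (1 - a) *: w)) <= a * fine (r x) + (1 - a) * fine (r w).
Proof.
move=> noo cr xd wd a01; have := cr x w a a01.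
rewrite (fin_edom noo xd) (fin_edom noo wd) -!EFinM -EFinD => H.
have yd : edom r (a *: x + (1 - a) *: w) by apply: le_lt_trans H _; rewrite ltry.
by split => //; move: H; rewrite (fin_edom noo yd) lee_fin.
Qed.

Lemma compact_norm_le (c : 'rV[R]_n) (rho : R) : 0 < rho ->
  compact [set w | `|w - c| <= rho].
Proof.
move=> rho0; apply: bounded_closed_compact.
  exists (rho + `|c|); split; first exact: num_real.
  move=> M HM w /= wc; rewrite (le_trans _ (ltW HM))//.
  by rewrite -[w](subrK c) (le_trans (ler_normD _ _))// lerD2r.
rewrite (_ : [set _ | _] = closed_ball c rho); first exact: closed_ball_closed.
rewrite closed_ballE//.
by apply/seteqP; split => w /=; rewrite /closed_ball_/= distrC.
Qed.

(** A weak substitute for an affine minorant. On the unit ball around [w0] the function has a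
    minimum; a farther [w] is joined to [w0], and convexity at the point of that segment lying on
    the unit sphere bounds [r w] below linearly in the distance. *)
Lemma proper_closed_convex_lower_bound r w0 :
  proper_closed_convex r -> edom r w0 ->
  exists2 C : R, 0 <= C & forall w, edom r w ->
    - C * (1 + norm2 (w - w0)) <= fine (r w).
Proof.
move=> [[noo _] lr cr] d0.
have [|p Kp minp] := lsc_min_compact (@compact_norm_le w0 _ ltr01) _ lr noo.
  by exists w0; rewrite /= subrr normr0.
have pd : edom r p.
  by apply: le_lt_trans (minp w0 _) d0; rewrite /= subrr normr0.
have bK w : edom r w -> `|w - w0| <= 1 -> fine (r p) <= fine (r w).
  by move=> wd /minp; rewrite (fin_edom noo wd) (fin_edom noo pd) lee_fin.
set b := fine (r p) in bK.
exists (`|b| + `|fine (r w0)|); first by rewrite addr_ge0.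
move=> w wd; have := ler_norm_norm2 (w - w0).
have := ler_norm b; have := ler_norm (- b).
have := ler_norm (fine (r w0)); have := ler_norm (- fine (r w0)); rewrite !normrN.
set N := norm2 _; set rho := `|w - w0| => h1 h2 h3 h4 h5.
have N0 : 0 <= N := norm2_ge0 _.
have [r1|r1] := leP rho 1; first by have := bK w wd r1; nra.
have r0 : 0 < rho by lra.
have a01 : 0 <= rho^-1 <= 1 by rewrite invr_ge0 ltW//= invf_le1// ltW.
have [yd] := econvex_fine noo cr wd d0 a01.
move/(le_trans (bK _ yd _)).
have -> : rho^-1 *: w + (1 - rho^-1) *: w0 - w0 = rho^-1 *: (w - w0).
  by apply/rowP => i; rewrite !mxE; ring.
rewrite normrZ gtr0_norm ?invr_gt0// -/rho mulVf ?gt_eqF// lexx => /(_ erefl).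
rewrite -(ler_pM2l r0) mulrDr !mulrA mulrBr mulr1 divff ?gt_eqF// mul1r.
nra.
Qed.

(** The quadratic growth of [psi] beats the linear lower bounds, so outside a large ball the sum
    exceeds its value at [w0], and the minimum over the compact ball is global. *)
Lemma coercive_min r w0 (psi : 'rV[R]_n -> R) (c b k : R) :
  proper_closed_convex r -> edom r w0 -> 0 < k ->
  (forall w, c - b * norm2 (w - w0) + k * norm2 (w - w0) ^+ 2 <= psi w) ->
  lower_semicontinuous (fun w => r w + (psi w)%:E)%E ->
  exists2 p, edom r p & forall w, (r p + (psi p)%:E <= r w + (psi w)%:E)%E.
Proof.
move=> pr d0 k0 psi_ge lF.
have [C C0 HC] := proper_closed_convex_lower_bound pr d0.
have [[noo _] lr cr] := pr.
set F0 := fine (r w0) + psi w0.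
(* Chosen so that [t > rho] gives [(t - 1) * k > C + |b| + |F0 + C - c|]; multiplied by [t], this
   makes [k * t ^ 2] dominate every other term. *)
set rho := 1 + (C + `|b| + `|F0 + C - c|) / k.
have q0 : 0 <= (C + `|b| + `|F0 + C - c|) / k.
  by rewrite divr_ge0 ?(ltW k0)// !addr_ge0.
have rho0 : 0 < rho by rewrite /rho; lra.
have Fnoo w : (r w + (psi w)%:E)%E != -oo%E.
  by rewrite -ltNye lteNye adde_eq_ninfty negb_or noo.
have [|p Kp minp] := lsc_min_compact (@compact_norm_le w0 _ rho0) _ lF Fnoo.
  by exists w0; rewrite /= subrr normr0 ltW.
have p0 := minp w0; rewrite /= subrr normr0 ltW// in p0; have {}p0 := p0 erefl.
exists p.
  move: p0; rewrite (fin_edom noo d0) -EFinD /edom/= ltNge leye_eq => p0.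
  by apply/negP => /eqP E; move: p0; rewrite E addye.
move=> w; have [wK|wK] := leP `|w - w0| rho; first exact: minp.
have [wd|/notin_edom->] := pselect (edom r w); last by rewrite addye// leey.
apply: (le_trans p0); rewrite (fin_edom noo d0) (fin_edom noo wd) -!EFinD lee_fin.
apply: le_trans (lerD (HC w wd) (psi_ge w)).
have := lt_le_trans wK (ler_norm_norm2 _); rewrite -/F0.
set t := norm2 _ => rt.
have t1 : 1 < t by move: rt q0; rewrite /rho; lra.
have : C + `|b| + `|F0 + C - c| < (t - 1) * k.
  by rewrite -ltr_pdivrMr//; move: rt; rewrite /rho; lra.
have := ler_norm b; have := ler_norm (F0 + C - c).
have := normr_ge0 (F0 + C - c); have := normr_ge0 b.
set B := `|b|; set D := `|F0 + C - c| => B0 D0 hD hB H.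
have : D * t < ((t - 1) * k - C - B) * t by rewrite ltr_pM2r; lra.
have : D <= D * t by rewrite ler_peMr// ltW.
have : b * t <= B * t by rewrite ler_pM2r//; lra.
nra.
Qed.

Lemma lsc_addr_continuous r (psi : 'rV[R]_n -> R) :
  (forall x, r x != -oo%E) -> lower_semicontinuous r -> continuous psi ->
  lower_semicontinuous (fun w => r w + (psi w)%:E)%E.
Proof.
move=> noo lr cpsi x a ax.
have [e e0 ae] : exists2 e, 0 < e & ((a + e - psi x)%:E < r x)%E.
  move: ax (noo x); case: (r x) => [s| |]//=.
    rewrite -EFinD lte_fin => ax _; exists ((s + psi x - a) / 2).
      by rewrite divr_gt0//; lra.
    by rewrite lte_fin; lra.
  by move=> _ _; exists 1; rewrite ?ltr01// ltry.
have [V nV HV] := lr _ _ ae.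
have nW : nbhs x [set w | psi x - e < psi w].
  have xe : psi x > psi x - e by lra.
  exact: (cvgr_gt _ (cpsi x) _ xe).
exists (V `&` [set w | psi x - e < psi w]); first exact: filterI.
move=> w [/HV Vw /= Ww]; move: Vw; case: (r w) => [s| |]//=.
  by rewrite -EFinD !lte_fin; lra.
by move=> _; rewrite addye// ltry.
Qed.

Lemma escale_proper_closed_convex (tau : R) r : 0 < tau ->
  proper_closed_convex r -> proper_closed_convex (escale tau r).
Proof.
move=> tau0 [[noo [x0 d0]] lr cr]; split.
- split; last first.
    by exists x0; rewrite /edom/= /escale (fin_edom noo d0) -EFinM ltry.
  move=> x; rewrite /escale; move: (noo x); case: (r x) => [s| |]//=.
  by rewrite gt0_muley.
- move=> x a ax.
  have [|V nV HV] := lr x (a / tau).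
    move: ax (noo x); rewrite /escale; case: (r x) => [s| |]//=.
      by rewrite -EFinM !lte_fin ltr_pdivrMr// mulrC.
    by rewrite !ltry.
  exists V => // w /HV; rewrite /escale; case: (r w) => [s| |]//=.
    by rewrite -EFinM !lte_fin ltr_pdivrMr// mulrC.
  by move=> _; rewrite gt0_muley// ltry.
- move=> x y a a01; rewrite /escale.
  have [a0 a1] := andP a01.
  have := lee_wpmul2l (_ : (0 <= tau%:E)%E) (cr x y a a01).
  rewrite lee_fin ltW// => /(_ erefl) /le_trans; apply.
  (* Off the domain the right-hand side is [+oo], unless the coefficient vanishes; then the
     convention [0 * +oo = 0] leaves a trivial inequality. *)
  have [xd|/notin_edom->] := pselect (edom r x); last first.
    have [->|an0] := eqVneq a 0; first by rewrite !mul0e !add0e subr0 !mul1e.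
    have a00 : 0 < a by rewrite lt_neqAle eq_sym an0.
    rewrite !gt0_muley ?lte_fin// [in leRHS]addye ?leey//.
    move: (noo y); case: (r y) => [s| |]//= _.
    have [->|bn0] := eqVneq a 1; first by rewrite subrr mul0e.
    by rewrite !gt0_muley ?lte_fin// subr_gt0 lt_neqAle bn0.
  have [yd|/notin_edom->] := pselect (edom r y); last first.
    have [->|bn0] := eqVneq a 1; first by rewrite subrr !mul0e !adde0 !mul1e.
    have b0 : 0 < 1 - a by rewrite subr_gt0 lt_neqAle bn0.
    rewrite !gt0_muley ?lte_fin// (fin_edom noo xd) -!EFinM.
    by rewrite [in leRHS]addey// leey.
  rewrite (fin_edom noo xd) (fin_edom noo yd) -!EFinM -!EFinD lee_fin.
  by lra.
Qed.

Lemma edom_escale (tau : R) r : 0 < tau -> (forall x, r x != -oo%E) ->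
  edom (escale tau r) = edom r.
Proof.
move=> tau0 noo; apply/seteqP; split => x; rewrite /edom/= /escale.
  by move: (noo x); case: (r x) => [s| |]//= _; rewrite ?ltry// gt0_muley.
by move: (noo x); case: (r x) => [s| |]//= _; rewrite -EFinM !ltry.
Qed.

(** Rules out the default value in [prox]: half the squared distance to [x] is continuous and grows
    quadratically, so a minimizer exists. *)
Lemma proxP r x : proper_closed_convex r -> is_prox r x (prox r x).
Proof.
move=> pr; have [[noo [w0 d0]] lr cr] := pr.
suff [p Hp] : exists p, is_prox r x p.
  by apply: (@xgetPex _ 0 [set p | is_prox r x p]); exists p.
pose psi w : R := norm2 (w - x) ^+ 2 / 2.
have [|||p pd Hp] := @coercive_min r w0 psi 0 (norm2 (w0 - x)) 2^-1 pr d0.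
- by rewrite invr_gt0.
- move=> w; rewrite /psi.
  have -> : w - x = (w - w0) - (x - w0) by rewrite opprB addrA subrK.
  rewrite [in leRHS]sqr_norm2B.
  have := cauchy_schwarz (w - w0) (x - w0); rewrite (norm2B x).
  have := sqr_ge0 (norm2 (w0 - x)); rewrite !expr2; nra.
- apply: lsc_addr_continuous => // y; rewrite /psi.
  exact: (cvgM (@sqr_norm2B_continuous _ _ x y) (cvg_cst _)).
- by exists p.
Qed.

(** The minimizer [p] is compared with [p + a (w - p)]; convexity of [r] makes the gain linear in
    [a], up to a term in [a ^ 2] that disappears after dividing by [a]. *)
Lemma prox_variational r x w : proper_closed_convex r -> edom r w ->
  edom r (prox r x) /\
  dotv (x - prox r x) (w - prox r x) <= fine (r w) - fine (r (prox r x)).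
Proof.
move=> pr wd; have := proxP x pr; set p := prox r x => Hp.
have [[noo _] lr cr] := pr.
have pd : edom r p.
  have := Hp w; rewrite (fin_edom noo wd) -EFinD /edom/= => H.
  rewrite ltNge leye_eq; apply/negP => /eqP E.
  by move: H; rewrite E addye// leye_eq.
split=> //; rewrite -subr_ge0.
apply: (@ge0_affine_near0 _ (norm2 (w - p) ^+ 2 / 2)) => a /andP[a0 a1].
have [|yd Hy] := @econvex_fine r w p a noo cr wd pd; first by rewrite ltW.
have := Hp (a *: w + (1 - a) *: p).
rewrite (fin_edom noo yd) (fin_edom noo pd) -!EFinD lee_fin/=.
have -> : a *: w + (1 - a) *: p - x = (p - x) + a *: (w - p).
  by apply/rowP => i; rewrite !mxE; ring.
rewrite [norm2 (p - x + _) ^+ 2]sqr_norm2D norm2Z gtr0_norm// dotvZr.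
rewrite -[x - p]opprB dotvNl.
set A := norm2 (p - x); set B := norm2 (w - p); set D := dotv _ _ => H.
rewrite -(ler_pM2l a0) mulr0; nra.
Qed.

Lemma prox_escale_variational (tau : R) r x : 0 < tau -> proper_closed_convex r ->
  edom r (prox (escale tau r) x) /\
  forall w, edom r w ->
  tau^-1 * dotv (x - prox (escale tau r) x) (w - prox (escale tau r) x)
    <= fine (r w) - fine (r (prox (escale tau r) x)).
Proof.
move=> tau0 pr; have [[noo [w0 d0]] lr cr] := pr.
have := @prox_variational (escale tau r) x _ (escale_proper_closed_convex tau0 pr).
set p := prox _ _; rewrite edom_escale// => H.
have [pd _] := H _ d0; split => // w wd.
have [_] := H _ wd; rewrite /escale.
rewrite {1}(fin_edom noo wd) {1}(fin_edom noo pd) -!EFinM/= -mulrBr.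
by rewrite ler_pdivrMl.
Qed.

Lemma edom_segment r (a : R) p q :
  proper_closed_convex r -> edom r p -> edom r q -> 0 <= a <= 1 ->
  edom r (p + a *: (q - p)).
Proof.
move=> [[noo _] _ cr] pd qd a01.
have -> : p + a *: (q - p) = a *: q + (1 - a) *: p.
  by apply/rowP => i; rewrite !mxE; ring.
by have [] := econvex_fine noo cr qd pd a01.
Qed.

(** Firm nonexpansiveness, [|p - p'| ^ 2 <= <u - u', p - p'>], combined with the square of
    [(p - p') - (u - u')]. The points are abstract so that [p'] can be a second proximal point or a
    maximizer. *)
Lemma nonexpansive_of_variational u u' p p' :
  dotv (u - p) (p' - p) + dotv (u' - p') (p - p') <= 0 ->
  norm2 (p - p') ^+ 2 <= norm2 (u - u') ^+ 2.
Proof.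
move=> H; have := sqr_ge0 (norm2 ((p - p') - (u - u'))).
rewrite sqr_norm2B; move: H; rewrite !sqr_norm2 !dotvE.
rewrite !(dotvC p' p) !(dotvC u p) !(dotvC u' p) !(dotvC u p') !(dotvC u' p').
rewrite !(dotvC u' u).
lra.
Qed.

Lemma prox_escale_nonexpansive r (tau : R) u u' :
  0 < tau -> proper_closed_convex r ->
  norm2 (prox (escale tau r) u - prox (escale tau r) u') <= norm2 (u - u').
Proof.
move=> tau0 pr.
have [pd Hp] := prox_escale_variational u tau0 pr.
have [pd' Hp'] := prox_escale_variational u' tau0 pr.
move: (prox (escale tau r) u) (prox (escale tau r) u') pd Hp pd' Hp'.
move=> p p' pd Hp pd' Hp'.
rewrite -(@ler_pXn2r _ 2) ?nnegrE ?norm2_ge0//.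
apply: nonexpansive_of_variational.
rewrite -(ler_pM2l (_ : 0 < tau^-1)) ?invr_gt0// mulr0 mulrDr.
by have := Hp _ pd'; have := Hp' _ pd; lra.
Qed.

End proximal.

(** * The saddle function *)

Section directional_derivatives.
Context {R : realType} {V : normedModType R}.
Implicit Types (F : V -> R) (z d : V).

Lemma is_derive_line F z d (s df : R) :
  is_derive (z + s *: d) d F df -> is_derive s 1 (fun t : R => F (z + t *: d)) df.
Proof.
have E : (fun h : R => h^-1 *: (((fun t : R => F (z + t *: d)) \o shift s)
      (h *: (1 : R)) - F (z + s *: d)))
    = (fun h => h^-1 *: ((F \o shift (z + s *: d)) (h *: d) - F (z + s *: d))).
  apply/funext => h /=; congr (_ *: (F _ - _)).
  by rewrite [h *: 1]mulr1 scalerDl addrCA.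
by move=> [ex <-]; split; [move: ex|]; rewrite /derivable /derive E.
Qed.

(** As the derivative exists, right difference quotients determine it; hence bounds along a segment,
    known only for [0 < a <= 1], are enough. *)
Lemma derive_le_quadratic F z d (c b : R) : derivable F z d ->
  (forall a, 0 < a <= 1 -> F (z + a *: d) - F z <= a * c + a ^+ 2 * b) ->
  'D_d F z <= c.
Proof.
move=> dF H.
have cl : (fun a : R => c + a * b) @ 0^'+ --> c.
  apply: cvg_at_right_filter; rewrite -[X in _ --> X]addr0 -[X in _ + X](mul0r b).
  by apply: cvgD; [exact: cvg_cst|apply: cvgM; [exact: cvg_id|exact: cvg_cst]].
apply: (ler_cvg_to (cvg_dnbhs_at_right dF) cl); near=> a.
have a0 : 0 < a by near: a; exact: nbhs_right_gt.
have a1 : a <= 1 by near: a; apply: nbhs_right_le; exact: ltr01.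
rewrite /= [_ *: _]mulrC ler_pdivrMr// [_ + z]addrC.
by apply: le_trans (H a _) _; [rewrite a0|rewrite mulrDl; lra].
Unshelve. all: by end_near. Qed.

Lemma derive_ge_quadratic F z d (c b : R) : derivable F z d ->
  (forall a, 0 < a <= 1 -> a * c + a ^+ 2 * b <= F (z + a *: d) - F z) ->
  c <= 'D_d F z.
Proof.
move=> dF H; rewrite -lerN2 -deriveN//.
apply: (@derive_le_quadratic _ _ _ _ (- b)); first exact: derivableN.
by move=> a /H; rewrite opprfctE; lra.
Qed.

End directional_derivatives.

(** * Gradient inequalities, inner maximizers and contraction of the proximal gradient map *)

Section saddle.
Context {R : realType} {m n : nat}.
Variables (g : 'rV[R]_m -> \bar R) (h : 'rV[R]_n -> \bar R).
Variable f : 'rV[R]_m -> 'rV[R]_n -> R.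
Variables (Lf mu : R).
Hypothesis SC : assumption_SC g h f Lf mu.
Implicit Types (x u : 'rV[R]_m) (y v w : 'rV[R]_n).

Let pcc_g : proper_closed_convex g. Proof. by have [[]] := SC. Qed.
Let pcc_h : proper_closed_convex h. Proof. by have [[]] := SC. Qed.
Let hnoo y : h y != -oo%E. Proof. by have [[]] := pcc_h. Qed.
Let Lf0 : 0 <= Lf. Proof. by have [_ _ []] := SC. Qed.
Let mu0 : 0 < mu. Proof. by have [_ _ _ []] := SC. Qed.

Lemma differentiable_fpair x y : edom g x -> edom h y ->
  differentiable (fpair f) (x, y).
Proof. by have [_ [U [_ sU dU]] _ _] := SC => xd yd; apply/dU/sU. Qed.

(** The gradients are defined by partial derivatives; differentiability makes the derivative linear
    in the direction, which is then expanded in the canonical basis. *)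
Lemma derive_fpair x y u v : edom g x -> edom h y ->
  'D_(u, v) (fpair f) (x, y) = dotv (gradx f x y) u + dotv (grady f x y) v.
Proof.
move=> xd yd; have df := differentiable_fpair xd yd.
have E : (u, v) = \sum_i u 0 i *: (delta_mx 0 i : 'rV[R]_m, 0 : 'rV[R]_n)
    + \sum_j v 0 j *: (0 : 'rV[R]_m, delta_mx 0 j : 'rV[R]_n).
  have S1 k (F : 'I_k -> 'rV[R]_m * 'rV[R]_n) : (\sum_i F i).1 = \sum_i (F i).1.
    exact: big_morph.
  have S2 k (F : 'I_k -> 'rV[R]_m * 'rV[R]_n) : (\sum_i F i).2 = \sum_i (F i).2.
    exact: big_morph.
  apply: injective_projections; rewrite /= ?S1 ?S2/=.
    by rewrite [X in _ + X]big1 ?addr0 -?row_sum_delta// => i _; rewrite scaler0.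
  by rewrite [X in X + _]big1 ?add0r -?row_sum_delta// => i _; rewrite scaler0.
rewrite deriveE// E linearD !linear_sum.
congr (_ + _); apply: eq_bigr => i _; rewrite linearZ/= mxE deriveE//.
  by rewrite mulrC.
by rewrite mulrC.
Qed.

(** Strong concavity along the segment from [y] to [w], divided by [a -> 0]. The point [w] is
    arbitrary because [f x] is strongly concave on the whole space; existence of a maximizer relies
    on this. *)
Lemma concave_gradient_le x y w : edom g x -> edom h y ->
  f x w <= f x y + dotv (grady f x y) (w - y) - mu / 2 * norm2 (w - y) ^+ 2.
Proof.
move=> xd yd; have df := differentiable_fpair xd yd.
have D : 'D_(0, w - y) (fpair f) (x, y) = dotv (grady f x y) (w - y).
  by rewrite derive_fpair// dotv0 add0r.
suff : f x w - f x y + mu / 2 * norm2 (w - y) ^+ 2 <= dotv (grady f x y) (w - y).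
  by lra.
rewrite -D; apply: (@derive_ge_quadratic _ _ _ _ _ _
  (- (mu / 2 * norm2 (w - y) ^+ 2))); first exact: diff_derivable.
move=> a /andP[a0 a1]; have [_ _ _ [_ /(_ x xd w y a)]] := SC.
rewrite ltW//= a1 => /(_ erefl).
rewrite /fpair/= scaler0 addr0.
have -> : a *: w + (1 - a) *: y = y + a *: (w - y).
  by apply/rowP => i; rewrite !mxE; ring.
by set A := f x (y + _); set N := norm2 _; nra.
Qed.

Lemma grady_lipschitz x x' y y' : edom g x -> edom g x' -> edom h y -> edom h y' ->
  norm2 (grady f x y - grady f x' y') <= Lf * (norm2 (x - x') + norm2 (y - y')).
Proof.
move=> xd xd' yd yd'; have [_ _ [_ /(_ x x' y y' xd xd' yd yd') H] _] := SC.
apply: (@le_trans _ _ (pair_norm2 (gradx f x y - gradx f x' y')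
    (grady f x y - grady f x' y'))).
  rewrite -[leLHS]ger0_norm ?norm2_ge0// -sqrtr_sqr ler_sqrt ?lerDr ?sqr_ge0//.
  by rewrite addr_ge0 ?sqr_ge0.
apply: (le_trans H); rewrite ler_wpM2l//.
have a0 := norm2_ge0 (x - x'); have b0 := norm2_ge0 (y - y').
rewrite -[leRHS]ger0_norm ?addr_ge0// -sqrtr_sqr ler_sqrt ?sqr_ge0//; nra.
Qed.

Lemma gradx_lipschitz x x' y : edom g x -> edom g x' -> edom h y ->
  norm2 (gradx f x y - gradx f x' y) <= Lf * norm2 (x - x').
Proof.
move=> xd xd' yd; have [_ _ [_ /(_ x x' y y xd xd' yd yd) H] _] := SC.
apply: (@le_trans _ _ (pair_norm2 (gradx f x y - gradx f x' y)
    (grady f x y - grady f x' y))).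
  rewrite -[leLHS]ger0_norm ?norm2_ge0// -sqrtr_sqr ler_sqrt ?lerDl ?sqr_ge0//.
  by rewrite addr_ge0 ?sqr_ge0.
apply: (le_trans H); rewrite /pair_norm2 subrr norm2_0 expr0n addr0.
by rewrite sqrtr_sqr ger0_norm ?norm2_ge0.
Qed.

(** The mean value theorem on the segment, which stays in the convex domain of [g], evaluates the
    gradient at one intermediate point. This gives the factor [Lf] instead of [Lf / 2], which
    suffices here. *)
Lemma gradx_descent x x' y : edom g x -> edom g x' -> edom h y ->
  f x' y <= f x y + dotv (gradx f x y) (x' - x) + Lf * norm2 (x' - x) ^+ 2.
Proof.
move=> xd xd' yd.
pose phi (t : R) := fpair f ((x, y) + t *: (x' - x, 0)).
have ptE t : (x, y) + t *: (x' - x, 0) = (x + t *: (x' - x), y).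
  by apply: injective_projections; rewrite //= scaler0 addr0.
have dphi (t : R) : 0 <= t <= 1 ->
    is_derive t 1 phi (dotv (gradx f (x + t *: (x' - x)) y) (x' - x)).
  move=> t01; have td := edom_segment pcc_g xd xd' t01.
  have df := differentiable_fpair td yd.
  apply: is_derive_line; rewrite ptE; split; first exact: diff_derivable.
  by rewrite derive_fpair// dotv0 addr0.
have [t t01|t|c c01] := @MVT _ phi
    (fun t : R => dotv (gradx f (x + t *: (x' - x)) y) (x' - x)) 0 1 ltr01.
- by apply: dphi; rewrite !ltW ?(itvP t01).
- apply: derivable_within_continuous => s s01.
  by have [] := dphi s; rewrite ?(itvP s01).
have {}c01 : 0 <= c <= 1 by rewrite !ltW ?(itvP c01).
rewrite /phi !ptE /fpair/= scale0r scale1r addr0 subr0 mulr1.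
rewrite [x + (x' - x)]addrC subrK => H.
have cd := edom_segment pcc_g xd xd' c01.
have := gradx_lipschitz cd xd yd.
have := cauchy_schwarz (gradx f (x + c *: (x' - x)) y - gradx f x y) (x' - x).
have -> : x + c *: (x' - x) - x = c *: (x' - x) by rewrite addrC addKr.
rewrite dotvDl dotvNl norm2Z ger0_norm; last by case/andP: c01.
have := norm2_ge0 (x' - x).
have := norm2_ge0 (gradx f (x + c *: (x' - x)) y - gradx f x y).
move: c01 H; set A := norm2 _; set N := norm2 _; set B := dotv _ _.
move=> /andP[c0 c1] H A0 N0 H1 H2.
have : A * N <= Lf * (c * N) * N by rewrite ler_wpM2r.
have : c * (Lf * N ^+ 2) <= Lf * N ^+ 2.
  by rewrite ler_piMl// mulr_ge0// sqr_ge0.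
by nra.
Qed.

Definition maximizes x (ys : 'rV[R]_n) : Prop :=
  edom h ys /\ forall w, edom h w -> f x w - fine (h w) <= f x ys - fine (h ys).

(** Minimizes [h - f x], coercive by strong concavity. Lower semicontinuity has two cases: on the
    domain of [h] the function [f x] is continuous, and elsewhere [h] is [+oo], so a local upper
    bound on [f x] is enough. *)
Lemma exists_maximizer x : edom g x -> exists ys, maximizes x ys.
Proof.
move=> xd; have [[_ [y0 yd0]] lh ch] := pcc_h.
pose G := grady f x y0.
have ub w := concave_gradient_le w xd yd0.
have [||w|p pd Hp] := @coercive_min _ _ h y0 (fun w => - f x w) (- f x y0)
    (norm2 G) (mu / 2) pcc_h yd0.
- by rewrite divr_gt0.
- move=> w; have := ub w; have := cauchy_schwarz G (w - y0); rewrite -/G; lra.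
- move=> a aw.
  have [B [nB aB]] : exists B, nbhs w [set y | f x y < B] /\ ((a + B)%:E < h w)%E.
    have [wd|/notin_edom->] := pselect (edom h w); last first.
      (* The tangent of [f x] at [y0] is a continuous majorant [c + <G, y>], hence supplies the
         local bound. *)
      pose c := f x y0 - dotv G y0.
      exists (c + dotv G w + 1); split; last by rewrite ltry.
      have cG : (fun y => c + dotv G y) @ w --> c + dotv G w.
        exact: (cvgD (cvg_cst _) (@dotv_continuous _ _ G w)).
      have lt1 : c + dotv G w < c + dotv G w + 1 by lra.
      apply: filterS (cvgr_lt _ cG _ lt1) => y /=; apply: le_lt_trans.
      have := ub y; rewrite -/G dotvDr dotvNr /c.
      have : 0 <= mu / 2 * norm2 (y - y0) ^+ 2.
        by rewrite mulr_ge0 ?sqr_ge0// divr_ge0// ltW.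
      lra.
    have cf : f x y @[y --> w] --> f x w.
      have cp : (fun y : 'rV[R]_n => (x, y)) @ w --> (x, w).
        have c1 : {for w, continuous (fun=> x)} by exact: cst_continuous.
        have c2 : {for w, continuous (fun y : 'rV[R]_n => y)} by [].
        exact: (cvg_pair c1 c2).
      have cF := differentiable_continuous (differentiable_fpair xd wd).
      exact: (cvg_comp _ _ cp cF).
    move: aw; rewrite (fin_edom hnoo wd) -EFinD lte_fin => aw.
    exists (f x w + (fine (h w) - f x w - a) / 2); split.
      by apply: (cvgr_lt _ cf); lra.
    by rewrite lte_fin; lra.
  have [V nV HV] := lh _ _ aB.
  exists (V `&` [set y | f x y < B]); first exact: filterI.
  move=> y [/HV Vy /= By]; move: Vy; case: (h y) => [s| |]//=.
    by rewrite -EFinD !lte_fin; lra.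
  by move=> _; rewrite addye// ltry.
- exists p; split=> // w wd; have := Hp w.
  by rewrite (fin_edom hnoo wd) (fin_edom hnoo pd) -!EFinD lee_fin/=; lra.
Qed.

Lemma maximizer_variational x ys w : edom g x -> maximizes x ys -> edom h w ->
  dotv (grady f x ys) (w - ys) <= fine (h w) - fine (h ys).
Proof.
move=> xd [yd Hy] wd; have df := differentiable_fpair xd yd.
have <- : 'D_(0, w - ys) (fpair f) (x, ys) = dotv (grady f x ys) (w - ys).
  by rewrite derive_fpair// dotv0 add0r.
apply: (@derive_le_quadratic _ _ _ _ _ _ 0); first exact: diff_derivable.
move=> a /andP[a0 a1]; rewrite /fpair/= scaler0 addr0 mulr0 addr0.
have a01 : 0 <= a <= 1 by rewrite ltW.
have [[_ _] _ ch] := pcc_h.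
have [yd' Hh] := econvex_fine hnoo ch wd yd a01.
have E : ys + a *: (w - ys) = a *: w + (1 - a) *: ys.
  by apply/rowP => i; rewrite !mxE; ring.
have := Hy _ yd'; rewrite E; nra.
Qed.

(** Sum of first-order optimality at [ys] and of the strongly concave tangent inequality at [ys]. *)
Lemma quadratic_growth x ys w : edom g x -> maximizes x ys -> edom h w ->
  mu / 2 * norm2 (w - ys) ^+ 2 <= f x ys - fine (h ys) - (f x w - fine (h w)).
Proof.
move=> xd My wd; have := maximizer_variational xd My wd.
by have [yd _] := My; have := concave_gradient_le w xd yd; lra.
Qed.

(** The maximizer is a fixed point of the proximal gradient map, so nonexpansiveness leaves only the
    gradient step. Its cross term is at most [- 2 sigma mu N ^ 2] by strong monotonicity and its
    quadratic term at most [sigma mu N ^ 2] by [sigma Lf ^ 2 <= mu]. The parameter [kappa] will be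
    the estimate [mu_t]. *)
Lemma prox_gradient_contraction x y ys (sigma kappa : R) :
  edom g x -> edom h y -> maximizes x ys -> 0 < sigma ->
  sigma * Lf ^+ 2 <= mu -> kappa <= mu ->
  norm2 (prox (escale sigma h) (y + sigma *: grady f x y) - ys) ^+ 2
    <= (1 - sigma * kappa) * norm2 (y - ys) ^+ 2.
Proof.
move=> xd yd My s0 sL km; have [ysd _] := My.
have [pd Hp] := prox_escale_variational (y + sigma *: grady f x y) s0 pcc_h.
set p := prox _ _ in pd Hp *.
apply: (@le_trans _ _ (norm2 (y + sigma *: grady f x y
    - (ys + sigma *: grady f x ys)) ^+ 2)).
  apply: nonexpansive_of_variational.
  rewrite [ys + sigma *: _]addrC addrK dotvZl.
  rewrite -(ler_pM2l (_ : 0 < sigma^-1)) ?invr_gt0// mulr0 mulrDr.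
  rewrite [_ * (sigma * _)]mulrA mulVf ?gt_eqF// mul1r.
  by have := Hp _ ysd; have := maximizer_variational xd My pd; lra.
have -> : y + sigma *: grady f x y - (ys + sigma *: grady f x ys)
    = (y - ys) + sigma *: (grady f x y - grady f x ys).
  by rewrite scalerBr opprD !addrA [y + _ - _]addrAC.
rewrite sqr_norm2D norm2Z gtr0_norm// dotvZr.
have := grady_lipschitz xd xd yd ysd.
rewrite subrr norm2_0 add0r.
have := concave_gradient_le y xd ysd; have := concave_gradient_le ys xd yd.
rewrite (norm2B ys y) -[ys - y]opprB dotvNr !dotvDr !dotvDl !dotvNr !dotvNl.
have := norm2_ge0 (grady f x y - grady f x ys); have := norm2_ge0 (y - ys).
set N := norm2 _; set G := norm2 _ => N0 G0 H1 H2 H3.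
have G2 : G ^+ 2 <= Lf ^+ 2 * N ^+ 2.
  by rewrite -exprMn ler_pXn2r ?nnegrE// mulr_ge0.
have S : sigma ^+ 2 * G ^+ 2 <= sigma * mu * N ^+ 2.
  apply: (@le_trans _ _ (sigma * (sigma * Lf ^+ 2) * N ^+ 2)).
    by rewrite [_ * (_ * Lf ^+ 2)]mulrA -expr2 -mulrA ler_wpM2l ?sqr_ge0.
  by rewrite ler_wpM2r ?sqr_ge0// ler_wpM2l// ltW.
have K : sigma * kappa * N ^+ 2 <= sigma * mu * N ^+ 2.
  by rewrite ler_wpM2r ?sqr_ge0// ler_wpM2l// ltW.
rewrite exprMn !(dotvC y) !(dotvC ys); set Q := _ + (_ - _).
have : sigma * Q <= sigma * (- mu * N ^+ 2) by rewrite ler_pM2l// /Q; lra.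
lra.
Qed.

End saddle.

(** * The backtracking condition at a fresh state *)

(** Condition (i) over the reals. The descent in [x] pays for [a ^ 2 / t], [Lam] cancels against the
    ascent in [y], and what remains is a comparison of multiples of [Delta] and [a ^ 2]. *)
Lemma BC1_arith (R : realType) (l m mu Lf Delta a b e : R)
    (t gam Lam gx gx' fxy fx'y fx'y' hy hy' : R) :
  0 < l -> 0 < m -> m <= mu -> 0 <= Lf -> 2 * mu + 2 * Lf <= l ->
  0 <= a -> 0 <= b -> 0 <= e ->
  b <= a + e -> e ^+ 2 <= (4 - 2 * (l^-1 * m)) * Delta ->
  0 < t -> 0 < gam -> gam < 1 ->
  gx' + fx'y <= gx + fxy - (t^-1 - Lf) * a ^+ 2 ->
  fx'y' - hy' - (fx'y - hy) <= Lam + Lf * (a + b) * b ->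
  (t - (2 + 1 / gam) * t ^+ 2 * l) * (a ^+ 2 / t ^+ 2)
    + l^-1 * (e ^+ 2 / l^-1 ^+ 2)
    + l^-1 ^+ 2 * (m / 2) * (b ^+ 2 / l^-1 ^+ 2)
  <= Lam + 4 * (3 * l - 2 * m) * Delta + (gx + fxy - hy) - (gx' + fx'y' - hy') + 0.
Proof.
move=> l0 m0 mmu Lf0 lK a0 b0 e0 ab ey t0 g0 g1 dx asc.
have -> : (t - (2 + 1 / gam) * t ^+ 2 * l) * (a ^+ 2 / t ^+ 2)
    + l^-1 * (e ^+ 2 / l^-1 ^+ 2)
    + l^-1 ^+ 2 * (m / 2) * (b ^+ 2 / l^-1 ^+ 2)
  = t^-1 * a ^+ 2 - (2 + 1 / gam) * (l * a ^+ 2) + l * e ^+ 2 + m / 2 * b ^+ 2.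
  by field; rewrite !gt_eqF.
have gi : 1 <= 1 / gam by rewrite ler_pdivlMr// mul1r ltW.
have la0 : 0 <= l * a ^+ 2 by rewrite mulr_ge0 ?sqr_ge0// ltW.
have : 3 * (l * a ^+ 2) <= (2 + 1 / gam) * (l * a ^+ 2) by rewrite ler_wpM2r//; lra.
have lm : 0 < l^-1 * m by rewrite mulr_gt0// invr_gt0.
have lm1 : l^-1 * m <= 1 by rewrite ler_pdivrMl//; lra.
have le : l * e ^+ 2 <= (4 * l - 2 * m) * Delta.
  have -> : (4 * l - 2 * m) * Delta = l * ((4 - 2 * (l^-1 * m)) * Delta).
    by field; rewrite gt_eqF.
  by rewrite ler_pM2l.
have D0 : 0 <= Delta.
  have pos : 0 < 4 - 2 * (l^-1 * m) by lra.
  by rewrite -(pmulr_rge0 _ pos) (le_trans _ ey) ?sqr_ge0.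
have e4 : e ^+ 2 <= 4 * Delta by apply: (le_trans ey); rewrite ler_wpM2r//; lra.
have b2 : b ^+ 2 <= 8 * Delta + 2 * a ^+ 2.
  by have := sqr_ge0 (a - e); nra.
have b3 : (m / 2 + 3 / 2 * Lf) * b ^+ 2 <=
    (m / 2 + 3 / 2 * Lf) * (8 * Delta + 2 * a ^+ 2).
  by rewrite ler_wpM2l//; lra.
have ab2 : Lf * (a * b) <= Lf * (a ^+ 2 / 2 + b ^+ 2 / 2).
  by rewrite ler_wpM2l//; have := sqr_ge0 (a - b); nra.
(* The coefficients left to compare are [4 l + 2 m + 12 Lf] against [12 l - 8 m] for [Delta], and
   [m + 9/2 Lf] against [3 l] for [a ^ 2]. *)
have lD : (2 * mu + 2 * Lf) * Delta <= l * Delta by rewrite ler_wpM2r.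
have mD : m * Delta <= mu * Delta by rewrite ler_wpM2r.
have la : (2 * mu + 2 * Lf) * a ^+ 2 <= l * a ^+ 2 by rewrite ler_wpM2r ?sqr_ge0.
have ma : m * a ^+ 2 <= mu * a ^+ 2 by rewrite ler_wpM2r ?sqr_ge0.
have fD : 0 <= Lf * Delta by rewrite mulr_ge0.
have fa : 0 <= Lf * a ^+ 2 by rewrite mulr_ge0 ?sqr_ge0.
have na : 0 <= m * a ^+ 2 by rewrite mulr_ge0 ?sqr_ge0// ltW.
have nD : 0 <= m * Delta by rewrite mulr_ge0// ltW.
nra.
Qed.

(** Since [b ^ 2 <= 2 a ^ 2 + 2 e ^ 2], the bound on [e ^ 2] leaves a slack of [4 (1 - m / l) Delta]
    before multiplying by [l ^ 2]. *)
Lemma BC4_arith (R : realType) (l m mu Lf Delta a b e t : R) :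
  0 < l -> 0 < m -> m <= mu -> 0 <= Lf -> 2 * mu + 2 * Lf <= l ->
  0 <= a -> 0 <= b -> 0 <= e ->
  b <= a + e -> e ^+ 2 <= (4 - 2 * (l^-1 * m)) * Delta -> 0 < t ->
  b ^+ 2 / l^-1 ^+ 2 <=
  2 * (4 * (1 - l^-1 * m) / l^-1 ^+ 2 + 2 * l ^+ 2) * Delta
  + 2 * l ^+ 2 * t ^+ 2 * (a ^+ 2 / t ^+ 2).
Proof.
move=> l0 m0 mmu Lf0 lK a0 b0 e0 ab ey t0.
have -> : 2 * (4 * (1 - l^-1 * m) / l^-1 ^+ 2 + 2 * l ^+ 2) * Delta
  + 2 * l ^+ 2 * t ^+ 2 * (a ^+ 2 / t ^+ 2)
  = ((12 - 8 * (l^-1 * m)) * Delta + 2 * a ^+ 2) * l ^+ 2.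
  by field; rewrite !gt_eqF.
rewrite exprVn invrK ler_wpM2r ?sqr_ge0//.
have lm : 0 < l^-1 * m by rewrite mulr_gt0// invr_gt0.
have lm1 : l^-1 * m <= 1 by rewrite ler_pdivrMl//; lra.
have D0 : 0 <= Delta.
  have pos : 0 < 4 - 2 * (l^-1 * m) by lra.
  by rewrite -(pmulr_rge0 _ pos) (le_trans _ ey) ?sqr_ge0.
have : 0 <= (1 - l^-1 * m) * Delta by rewrite mulr_ge0//; lra.
by have := sqr_ge0 (a - e); nra.
Qed.

Section backtracking.
Context {R : realType} {m n : nat}.
Variables (g : 'rV[R]_m -> \bar R) (h : 'rV[R]_n -> \bar R).
Variable f : 'rV[R]_m -> 'rV[R]_n -> R.
Variables (Lf mu : R) (P : agda_inputs R).
Hypothesis SC : assumption_SC g h f Lf mu.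
Hypothesis VP : valid_inputs mu P.
Implicit Types s : agda_state R m n.

Let pcc_g : proper_closed_convex g. Proof. by have [[]] := SC. Qed.
Let pcc_h : proper_closed_convex h. Proof. by have [[]] := SC. Qed.
Let gnoo x : g x != -oo%E. Proof. by have [[]] := pcc_g. Qed.
Let hnoo y : h y != -oo%E. Proof. by have [[]] := pcc_h. Qed.
Let Lf0 : 0 <= Lf. Proof. by have [_ _ []] := SC. Qed.
Let mu0 : 0 < mu. Proof. by have [_ _ _ []] := SC. Qed.
Let gamma_gt0 : 0 < gamma P. Proof. by have [_ _ /andP[]] := VP. Qed.
Let gamma_lt1 : gamma P < 1. Proof. by have [_ _ /andP[]] := VP. Qed.

(** The ordering [mu_t <= l_t <= L_t] makes [1 - sigma_t mu_t], [2 - sigma_t mu_t] and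
    [15 L_t - 8 mu_t] nonnegative. *)
Lemma taut_gt0 s : 0 < mus s -> mus s <= ls s -> ls s <= Ls s -> 0 < taut P s.
Proof.
move=> m0 ml lL; have [_ /andP[_ g1] _ _ _] := VP.
have l0 : 0 < ls s by lra.
rewrite /taut mulr_gt0 ?divr_gt0 ?subr_gt0// invr_gt0.
have s1 : sigmat s * mus s <= 1 by rewrite /sigmat mulrC ler_pdivrMr// mul1r.
rewrite ltr_wpDr ?addr_gt0 ?divr_gt0//.
rewrite divr_ge0 ?exprn_ge0 ?(ltW m0)// !mulr_ge0 ?exprn_ge0//; lra.
Qed.

Lemma xtilde_edom s : 0 < taut P s -> edom g (xtilde g f P s).
Proof.
move=> t0.
by have [] := prox_escale_variational (xs s - taut P s *: gradx f (xs s) (ys s)) t0 pcc_g.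
Qed.

Lemma ytilde_edom s : 0 < ls s -> edom h (ytilde g h f P s).
Proof.
rewrite -invr_gt0 => s0.
by have [] := prox_escale_variational
  (ys s + sigmat s *: grady f (xtilde g f P s) (ys s)) s0 pcc_h.
Qed.

Lemma LagE x y : edom g x -> edom h y ->
  Lag g h f x y = (fine (g x) + f x y - fine (h y))%:E.
Proof.
by move=> xd yd; rewrite /Lag (fin_edom gnoo xd) (fin_edom hnoo yd) -EFinD.
Qed.

Lemma sq_GxE s : sq_Gx g f P s =
  norm2 (xtilde g f P s - xs s) ^+ 2 / taut P s ^+ 2.
Proof.
rewrite /sq_Gx /Gx norm2Z -/(xtilde g f P s) norm2B exprMn real_normK ?num_real//.
by rewrite mulrC exprVn.
Qed.

Lemma sqr_norm2_Gy (sigma : R) x y :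
  norm2 (Gy h f sigma x y) ^+ 2 =
  norm2 (prox (escale sigma h) (y + sigma *: grady f x y) - y) ^+ 2 / sigma ^+ 2.
Proof.
by rewrite /Gy norm2Z exprMn real_normK ?num_real// mulrC exprVn.
Qed.

Lemma sq_Gy_tildeE s : sq_Gy_tilde g h f P s =
  norm2 (ytilde g h f P s - ys s) ^+ 2 / sigmat s ^+ 2.
Proof. by rewrite /sq_Gy_tilde sqr_norm2_Gy. Qed.

Lemma prox_gradx_descent s : edom g (xs s) -> edom h (ys s) -> 0 < taut P s ->
  fine (g (xtilde g f P s)) + f (xtilde g f P s) (ys s) <=
  fine (g (xs s)) + f (xs s) (ys s)
    - ((taut P s)^-1 - Lf) * norm2 (xtilde g f P s - xs s) ^+ 2.
Proof.
move=> xd yd t0; have := xtilde_edom t0; rewrite /xtilde.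
set t := taut P s in t0 *; set x := xs s in xd *; set y := ys s in yd *.
have [_ /(_ _ xd)] := prox_escale_variational (x - t *: gradx f x y) t0 pcc_g.
set x' := prox _ _ => H xd'; have := gradx_descent SC xd xd' yd.
move: H; rewrite [x - _ - x']addrAC dotvDl dotvNl dotvZl mulrDr mulrN mulKf ?gt_eqF//.
by rewrite -sqr_norm2 (norm2B x) -[x - x']opprB dotvNr; lra.
Qed.

(* The last hypothesis bounds the ascent in [y]; each mode of the algorithm
   supplies it through its own [Lambdas]. *)
Lemma BC_of_bounds s (ys' : 'rV[R]_n) :
  edom g (xs s) -> edom h (ys s) -> 0 < mus s -> mus s <= mu ->
  ls s <= Ls s -> 2 * mu + 2 * Lf <= ls s -> Lf ^+ 2 <= mu * ls s -> Rs s = 0 ->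
  maximizes h f (xs s) ys' -> norm2 (ys s - ys') ^+ 2 <= Deltas s ->
  (let x' := xtilde g f P s in let y' := ytilde g h f P s in
   f x' y' - fine (h y') - (f x' (ys s) - fine (h (ys s)))
   <= Lambdas s + Lf * (norm2 (x' - xs s) + norm2 (y' - ys s)) * norm2 (y' - ys s)) ->
  BC g h f P s.
Proof.
move=> xd yd m0 mmu lL lK lLf R0 My Dy /=.
have [Lf_ge0 mu_gt0] : 0 <= Lf /\ 0 < mu by split.
have l0 : 0 < ls s by lra.
have t0 : 0 < taut P s by apply: taut_gt0 => //; lra.
have dx := prox_gradx_descent xd yd t0.
have s0 : 0 < sigmat s by rewrite invr_gt0.
have sL : sigmat s * Lf ^+ 2 <= mu by rewrite ler_pdivrMl// mulrC.
have ctr := prox_gradient_contraction SC xd yd My s0 sL mmu.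
have xd' := xtilde_edom t0; have yd' := ytilde_edom l0.
rewrite /BC /BC1 /BC2 /BC3 /BC4 R0 (LagE xd yd) (LagE xd' yd').
rewrite sq_GxE sq_Gy_tildeE sqr_norm2_Gy.
have y'E : ytilde g h f P s =
  prox (escale (sigmat s) h) (ys s + sigmat s *: grady f (xtilde g f P s) (ys s)) by [].
(* [p] is the proximal step in [y] taken at the old [x_t], the point that the contraction
   controls. *)
move: y'E dx ctr xd' yd'; have [p pE] : exists p,
  p = prox (escale (sigmat s) h) (ys s + sigmat s *: grady f (xs s) (ys s)) by eexists.
rewrite -pE; move: (xtilde g f P s) (ytilde g h f P s) => x' y' y'E dx ctr xd' yd' asc.
(* From [|A - B| ^ 2 <= 2 |A| ^ 2 + 2 |B| ^ 2], where the contraction bounds [|A| ^ 2] by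
   [(1 - sigma_t mu_t) |B| ^ 2]. *)
have ey : norm2 (p - ys s) ^+ 2 <= (4 - 2 * (sigmat s * mus s)) * Deltas s.
  have -> : p - ys s = (p - ys') - (ys s - ys') by rewrite opprB addrA subrK.
  move: ctr Dy; set A := p - ys'; set B := ys s - ys' => ctr Dy.
  have := sqr_ge0 (norm2 (A + B)); rewrite (sqr_norm2D A B) (sqr_norm2B A B).
  have sm : 0 <= sigmat s * mus s by rewrite mulr_ge0// ltW.
  have sm1 : sigmat s * mus s <= 1 by rewrite ler_pdivrMl//; lra.
  have : (2 - sigmat s * mus s) * norm2 B ^+ 2 <= (2 - sigmat s * mus s) * Deltas s.
    by rewrite ler_wpM2l//; lra.
  lra.
(* The two proximal arguments differ only by [sigma_t] times a change of gradient due to [x], and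
   [Lf <= l_t]. *)
have pq : norm2 (y' - p) <= norm2 (x' - xs s).
  rewrite y'E pE; apply: le_trans (prox_escale_nonexpansive _ _ s0 pcc_h) _.
  rewrite opprD addrACA subrr add0r -scalerBr norm2Z gtr0_norm//.
  rewrite ler_pdivrMl//; apply: le_trans (grady_lipschitz SC xd' xd yd yd) _.
  rewrite subrr norm2_0 addr0.
  by rewrite ler_wpM2r ?norm2_ge0//; lra.
have b_ae : norm2 (y' - ys s) <= norm2 (x' - xs s) + norm2 (p - ys s).
  exact: le_trans (norm2_triangle _ p _) (lerD pq (lexx _)).
have gl := grady_lipschitz SC xd' xd' yd' yd.
have cl := concave_gradient_le SC (ys s) xd' yd'.
have cs := cauchy_schwarz (grady f x' y' - grady f x' (ys s)) (ys s - y').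
move: gl; rewrite subrr norm2_0 add0r => gl.
apply/and4P; split.
- rewrite -!EFinB -!EFinD lee_fin.
  exact: (BC1_arith l0 m0 mmu Lf_ge0 lK (norm2_ge0 _) (norm2_ge0 _) (norm2_ge0 _)
    b_ae ey t0 gamma_gt0 gamma_lt1 dx asc).
(* Condition (ii): the concave tangent at [y'], with its gradient moved to [y_t] at a cost of
   [Lf N ^ 2 <= l_t / 2 * N ^ 2]. *)
- move: cl cs gl; rewrite (norm2B (ys s)) -[ys s - _]opprB.
  set u := grady f _ _; set v := grady f _ _; set d := _ - ys s.
  rewrite !dotvDl !dotvNl !dotvNr; set N := norm2 d; set G := norm2 _.
  have N0 : 0 <= N := norm2_ge0 _.
  move: (dotv u d) (dotv v d) (f _ _) (f _ _) => A B F F' H1 H2 H3.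
  have H4 : G * N <= Lf * N * N by rewrite ler_wpM2r.
  have H5 : 0 <= mu / 2 * N ^+ 2 by rewrite mulr_ge0 ?sqr_ge0// divr_ge0// ltW.
  have H6 : 2 * Lf * N ^+ 2 <= ls s * N ^+ 2 by rewrite ler_wpM2r ?sqr_ge0//; lra.
  by nra.
- by apply: (le_trans gl); rewrite ler_wpM2r ?norm2_ge0//; lra.
- exact: (BC4_arith l0 m0 mmu Lf_ge0 lK (norm2_ge0 _) (norm2_ge0 _) (norm2_ge0 _)
    b_ae ey t0).
Qed.

(** What step (1) guarantees about [y_t]. In the proximal mode it involves the current [L_t], so it
    may fail after an enlargement until step (1) is run again. *)
Definition fresh s : Prop :=
  if max_solver P then max_approx g h f P s (ys s)
  else exists yo, [/\ edom h yo,
    ys s = prox (escale (Ls s)^-1 h) (yo + (Ls s)^-1 *: grady f (xs s) yo)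
    & ds s = norm2 (ys s - yo)].

Lemma max_approx_le s y w : edom g (xs s) -> edom h y -> edom h w ->
  max_approx g h f P s y ->
  f (xs s) w - fine (h w) <= f (xs s) y - fine (h y) + zeta P.
Proof.
move=> xd yd wd /(_ w); rewrite (LagE xd yd) (LagE xd wd) -EFinD lee_fin; lra.
Qed.

Lemma max_approx_distance s (ys' : 'rV[R]_n) :
  edom g (xs s) -> edom h (ys s) -> 0 < mus s -> mus s <= mu ->
  max_approx g h f P s (ys s) -> maximizes h f (xs s) ys' ->
  norm2 (ys s - ys') ^+ 2 <= 2 * zeta P / mus s.
Proof.
move=> xd yd m0 mmu /max_approx_le Ma My.
have [ysd _] := My; have := Ma _ xd yd ysd.
have := quadratic_growth SC xd My yd.
have := sqr_ge0 (norm2 (ys s - ys')); set N := _ ^+ 2 => N0 H1 H2.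
rewrite ler_pdivlMr//.
have : mus s * N <= mu * N by rewrite ler_wpM2r.
lra.
Qed.

(** The increase from [y_t] to [y'] at [x'] is compared with the one at [x_t], which approximate
    maximality bounds. Concavity bounds the first above and the second below by gradient terms whose
    difference is Lipschitz. *)
Lemma max_approx_ascent s x' y' :
  edom g (xs s) -> edom h (ys s) -> edom g x' -> edom h y' ->
  max_approx g h f P s (ys s) ->
  f x' y' - fine (h y') - (f x' (ys s) - fine (h (ys s)))
  <= zeta P + Lf * (norm2 (x' - xs s) + norm2 (y' - ys s)) * norm2 (y' - ys s).
Proof.
move=> xd yd xd' yd' Ma; have := max_approx_le xd yd yd' Ma.
have [Lf_ge0 mu_gt0] : 0 <= Lf /\ 0 < mu by split.
have := concave_gradient_le SC y' xd' yd.
have := concave_gradient_le SC (ys s) xd yd'.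
have := grady_lipschitz SC xd' xd yd yd'.
have := cauchy_schwarz (grady f x' (ys s) - grady f (xs s) y') (y' - ys s).
rewrite (norm2B (ys s) y') -[ys s - y']opprB dotvDl dotvNl !dotvNr.
have := norm2_ge0 (y' - ys s).
move: (norm2 (_ - _)) (norm2 (x' - xs s)) (norm2 (y' - ys s)) => G a b.
move: (dotv _ _) (dotv _ _) => A B b0 H1 H2 H3 H4.
have : G * b <= Lf * (a + b) * b by rewrite ler_wpM2r.
have : 0 <= mu / 2 * b ^+ 2 by rewrite mulr_ge0 ?sqr_ge0// divr_ge0// ltW.
lra.
Qed.

(** An error bound. With [c = mu_t / L_t], the contraction gives [u <= (1 - c / 2) q] for the
    distances [u], [q] to the maximizer after and before the step; as [q <= d + u], it follows that
    [u c / 2 <= d]. *)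
Lemma prox_gradient_distance s yo (ys' : 'rV[R]_n) :
  edom g (xs s) -> edom h yo -> 0 < mus s -> mus s <= mu -> mus s <= Ls s ->
  Lf ^+ 2 <= mu * Ls s ->
  ys s = prox (escale (Ls s)^-1 h) (yo + (Ls s)^-1 *: grady f (xs s) yo) ->
  maximizes h f (xs s) ys' ->
  norm2 (ys s - ys') <= (1 + 2 * Ls s / mus s) * norm2 (ys s - yo).
Proof.
move=> xd yod m0 mmu mL LfL yE My.
have L0 : 0 < Ls s by lra.
have sL : (Ls s)^-1 * Lf ^+ 2 <= mu by rewrite ler_pdivrMl// mulrC.
have s0 : 0 < (Ls s)^-1 by rewrite invr_gt0.
have := prox_gradient_contraction SC xd yod My s0 sL mmu; rewrite -yE.
have := norm2_triangle yo (ys s) ys'; rewrite (norm2B yo (ys s)).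
have := norm2_ge0 (ys s - ys'); have := norm2_ge0 (ys s - yo).
have := norm2_ge0 (yo - ys').
move: (norm2 (ys s - ys')) (norm2 (yo - ys')) (norm2 (ys s - yo)) => u q d.
move: (Ls s) (mus s) m0 mL L0 {mmu LfL yE sL s0} => L k k0 kL L0 q0 d0 u0 qdu uq.
set c := L^-1 * k in uq.
have c0 : 0 < c by rewrite mulr_gt0// invr_gt0.
have c1 : c <= 1 by rewrite ler_pdivrMl//; lra.
have uq' : u <= (1 - c / 2) * q.
  rewrite -(@ler_pXn2r _ 2) ?nnegrE ?mulr_ge0//; last by lra.
  apply: (le_trans uq); rewrite exprMn ler_wpM2r ?sqr_ge0//.
  by have := sqr_ge0 c; lra.
have : (1 - c / 2) * q <= (1 - c / 2) * (d + u) by rewrite ler_wpM2l//; lra.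
move=> H; have cd : 0 <= c * d by rewrite mulr_ge0// ltW.
have uc : u * (c / 2) <= d by lra.
have -> : (1 + 2 * L / k) * d = d + d / (c / 2).
  by rewrite /c; field; rewrite !gt_eqF.
by rewrite ler_wpDl// ler_pdivlMr//; lra.
Qed.

(** Optimality of the step producing [y_t] bounds the change of [h]. This costs [L_t d b], and
    moving the gradient from [yo] to [y_t] costs [Lf d b <= L_t d b]: hence the factor 2 in
    [Lambda_t]. *)
Lemma prox_gradient_ascent s yo x' y' :
  edom g (xs s) -> edom h yo -> edom g x' -> edom h y' -> edom h (ys s) ->
  0 < Ls s -> Lf <= Ls s ->
  ys s = prox (escale (Ls s)^-1 h) (yo + (Ls s)^-1 *: grady f (xs s) yo) ->
  f x' y' - fine (h y') - (f x' (ys s) - fine (h (ys s)))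
  <= 2 * norm2 (ys s - yo) * Ls s * norm2 (y' - ys s)
   + Lf * (norm2 (x' - xs s) + norm2 (y' - ys s)) * norm2 (y' - ys s).
Proof.
move=> xd yod xd' yd' yd L0 LfL yE.
have [Lf_ge0 mu_gt0] : 0 <= Lf /\ 0 < mu by split.
have s0 : 0 < (Ls s)^-1 by rewrite invr_gt0.
have [_ /(_ _ yd')] := prox_escale_variational
  (yo + (Ls s)^-1 *: grady f (xs s) yo) s0 pcc_h.
rewrite -yE invrK [yo + _ - _]addrAC dotvDl dotvZl mulrDr mulVKf ?gt_eqF//.
have := concave_gradient_le SC y' xd' yd.
have := grady_lipschitz SC xd' xd yd yod.
have := cauchy_schwarz (grady f x' (ys s) - grady f (xs s) yo) (y' - ys s).
have := cauchy_schwarz (ys s - yo) (y' - ys s).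
rewrite -[yo - ys s]opprB dotvNl.
rewrite [dotv (_ - grady f _ _) _]dotvDl dotvNl.
have := norm2_ge0 (y' - ys s).
have := norm2_ge0 (x' - xs s).
have := norm2_ge0 (ys s - yo).
move: (dotv _ _) (dotv _ _) (dotv (ys s - yo) _) => A B D.
move: (norm2 _) (norm2 (ys s - yo)) (norm2 (x' - xs s)) (norm2 (y' - ys s)) => G d a b.
move=> d0 a0 b0 H1 H2 H3 H4 H5.
have : G * b <= Lf * (a + d) * b by rewrite ler_wpM2r.
have : 0 <= mu / 2 * b ^+ 2 by rewrite mulr_ge0 ?sqr_ge0// divr_ge0// ltW.
have : Ls s * D <= Ls s * (d * b) by rewrite ler_pM2l.
have : Lf * (d * b) <= Ls s * (d * b) by rewrite ler_wpM2r// mulr_ge0.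
have : 0 <= Lf * b * b by rewrite !mulr_ge0.
lra.
Qed.

(** Both points lie in the domain of [h], so the diameter also bounds their distance. The first
    entry of the minimum is real, so [fine] meets no infinite value. *)
Lemma Delta_fresh_prox_ge s (y' : 'rV[R]_n) : ~~ max_solver P ->
  edom h (ys s) -> edom h y' ->
  norm2 (ys s - y') <= (1 + 2 * Ls s / mus s) * ds s ->
  norm2 (ys s - y') ^+ 2 <= Delta_fresh h P s.
Proof.
move=> ms yd yd' H; rewrite /Delta_fresh (negbTE ms).
have u0 := norm2_ge0 (ys s - y').
set A := _ * ds s ^+ 2; set M := Order.min _ _.
have uD : ((norm2 (ys s - y') ^+ 2)%:E <= Dy_bar h P ^+ 2)%E.
  have uD : ((norm2 (ys s - y'))%:E <= Dy_bar h P)%E.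
    rewrite /Dy_bar; case: ifP => _; last by rewrite leey.
    by apply: ereal_sup_ubound; exists (ys s), y'.
  by rewrite expr2 EFinM expe2 lee_pmul ?lee_fin.
have uM : ((norm2 (ys s - y') ^+ 2)%:E <= M)%E.
  rewrite /M le_min uD andbT lee_fin /A -exprMn ler_pXn2r ?nnegrE//.
  exact: le_trans H.
have fM : M \is a fin_num.
  rewrite fin_numE; apply/andP; split.
    by rewrite gt_eqF// (lt_le_trans _ uM)// ltNyr.
  by rewrite lt_eqF// /M gt_min ltry.
by rewrite -lee_fin fineK.
Qed.

Lemma refreshE s (s' := refresh g h f P s) :
  ((xs s' = xs s) * (ys s' = ys s) * (ls s' = ls s) * (Ls s' = Ls s)
  * (mus s' = mus s) * (ph s' = ph s) * (it s' = it s) * (flag s' = flag s)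
  * (ds s' = ds s))%type.
Proof. by rewrite /s' /refresh; case: ifP. Qed.

Lemma BC_fresh s : flag s -> fresh s ->
  edom g (xs s) -> edom h (ys s) -> 0 < mus s -> mus s <= mu ->
  ls s <= Ls s -> 2 * mu + 2 * Lf <= ls s -> Lf ^+ 2 <= mu * ls s ->
  check_succeeds g h f P s.
Proof.
move=> fl fr xd yd m0 mmu lL lK lLf.
have [Lf_ge0 mu_gt0] : 0 <= Lf /\ 0 < mu by split.
have l0 : 0 < ls s by lra.
have t0 : 0 < taut P s by apply: taut_gt0 => //; lra.
have xd' := xtilde_edom t0; have yd' := ytilde_edom l0.
have [ys' My] := exists_maximizer SC xd; have [ysd _] := My.
have xE : xtilde g f P (refresh g h f P s) = xtilde g f P s by rewrite /refresh fl.
have yE : ytilde g h f P (refresh g h f P s) = ytilde g h f P s by rewrite /refresh fl.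
have DE : Deltas (refresh g h f P s) = Delta_fresh h P s by rewrite /refresh fl.
have LE : Lambdas (refresh g h f P s) = Lambda_fresh g h f P s by rewrite /refresh fl.
have z0 : 0 < zeta P by have [[]] := VP.
have RE : Rs (refresh g h f P s) = 0 by rewrite /refresh fl.
rewrite /check_succeeds; apply: (BC_of_bounds (ys' := ys')).
all: rewrite ?xE ?yE ?DE ?LE ?refreshE; try assumption.
- move: fr; rewrite /fresh; case: ifPn => ms.
    move=> Ma; rewrite /Delta_fresh ms.
    exact: (max_approx_distance xd yd m0 mmu Ma My).
  move=> [yo [yod yo_E dE]]; apply: Delta_fresh_prox_ge; rewrite ?dE; try assumption.
  have mL : mus s <= Ls s by lra.
  have LL : Lf ^+ 2 <= mu * Ls s by apply: (le_trans lLf); rewrite ler_pM2l.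
  exact: (prox_gradient_distance xd yod m0 mmu mL LL yo_E My).
- cbv zeta; rewrite /Lambda_fresh; move: fr; rewrite /fresh.
  move: (xtilde g f P s) (ytilde g h f P s) xd' yd' {xE yE DE LE RE} => x' y' xd' yd'.
  case: ifPn => ms.
    move=> /(max_approx_ascent xd yd xd' yd') H; apply: (le_trans H).
    rewrite lerD2r lerDl !mulr_ge0 ?sqrtr_ge0 ?norm2_ge0//; lra.
  move=> [yo [yod yo_E dE]]; rewrite dE (norm2B (ys s) y').
  have L0 : 0 < Ls s by lra.
  have LL : Lf <= Ls s by lra.
  exact: (prox_gradient_ascent xd yod xd' yd' yd L0 LL yo_E).
Qed.

End backtracking.

(** * Runs of the algorithm *)

Section runs.
Context {R : realType} {m n : nat}.
Variables (g : 'rV[R]_m -> \bar R) (h : 'rV[R]_n -> \bar R).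
Variable f : 'rV[R]_m -> 'rV[R]_n -> R.
Variables (Lf mu : R) (P : agda_inputs R) (x0 : 'rV[R]_m) (y0 : 'rV[R]_n).
Hypothesis SC : assumption_SC g h f Lf mu.
Hypothesis VP : valid_inputs mu P.
Hypotheses (x0d : edom g x0) (y0d : edom h y0).
Local Notation state := (agda_state R m n).
Implicit Types s : state.
Local Notation stp := (step g h f mu P).
Local Notation succeeds := (check_succeeds g h f P).

Let pcc_h : proper_closed_convex h. Proof. by have [[]] := SC. Qed.

(** Outside the domain of [h] the Lagrangian is [-oo], which cannot be within [zeta] of its finite
    value at [y0]. *)
Lemma max_approx_edom s y : edom g (xs s) -> max_approx g h f P s y -> edom h y.
Proof.
move=> xd /(_ y0); rewrite (LagE SC xd y0d) => H.
have [//|/notin_edom E] := pselect (edom h y).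
by move: H; rewrite /Lag E /= addeNy addNye leeNy_eq.
Qed.

(** When [mu] is unknown, an enlargement multiplies [mu_t] and divides [L_t] by the same factor,
    whence the constant product. Approximate maximality survives an exit from the inner loop because
    [x_t] and [y_t] do not move, whereas [fresh] is claimed only inside that loop. *)
Record invariant s : Prop := Invariant {
  inv_x : edom g (xs s);
  inv_y : edom h (ys s);
  inv_l : l_init P <= ls s;
  inv_L : l_init P <= Ls s;
  inv_mus : 0 < mus s <= mu_init P;
  inv_mu : if mu_known P then mus s = mu else mus s * Ls s = mu_init P * l_init P;
  inv_lL : gamma P * ls s <= Ls s;
  inv_outer : ph s = Outer -> ls s <= Ls s;
  inv_solver : flag s -> max_solver P -> max_approx g h f P s (ys s);
  inv_fresh : ph s = Inner -> flag s -> fresh g h f P s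
}.

Lemma invariant_taut s : invariant s -> ls s <= Ls s -> 0 < taut P s.
Proof.
move=> I lL; have [[_ _ ml] _ _ _ _] := VP.
have [l1 /andP[m0 m1]] := (inv_l I, inv_mus I).
by apply: (taut_gt0 VP) => //; lra.
Qed.

Lemma invariant_initial s : initial P x0 y0 s -> invariant s.
Proof.
have [[_ m0 ml] _ /andP[g0 g1] _ mk] := VP.
case=> phE _ [xE yE] [lE lcE LE mE] fE.
split; rewrite ?xE ?yE ?lE ?LE ?mE ?fE ?m0//=.
  by case: ifP => // /mk.
by rewrite ger_pMl ?ltW//; lra.
Qed.

Lemma invariant_step s s' : invariant s -> stp s s' -> invariant s'.
Proof.
have [[_ m0 ml] _ /andP[g0 g1] r0 mk] := VP.
have [_ _ _ [mu_gt0 _]] := SC.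
move=> I; have tau0 := invariant_taut I.
case: I tau0 => xd yd l1 L1 /andP[m1 m2] mE lL oL Ms fr tau0 H.
case: H xd yd l1 L1 m1 m2 mE lL oL Ms fr tau0 => {}s.
- move=> y pE ms _ Ma xd yd l1 L1 m1 m2 mE lL oL Ms fr tau0.
  split=> //=; first exact: max_approx_edom Ma.
    by rewrite m1.
  by rewrite /fresh ms.
- move=> pE ms fl xd yd l1 L1 m1 m2 mE lL oL Ms fr tau0.
  split=> //=; first by rewrite m1.
    by move=> _ _; exact: Ms.
  by rewrite /fresh ms => _ _; exact: Ms.
- move=> pE ms xd yd l1 L1 m1 m2 mE lL oL Ms fr tau0.
  have s0 : 0 < (Ls s)^-1 by rewrite invr_gt0; lra.
  have [yd' _] := prox_escale_variational
    (ys s + (Ls s)^-1 *: grady f (xs s) (ys s)) s0 pcc_h.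
  split=> //=; first by rewrite m1.
    by rewrite (negbTE ms).
  by rewrite /fresh (negbTE ms) => _ _; exists (ys s).
- move=> [pE lL'] _ xd yd l1 L1 m1 m2 mE lL oL Ms fr tau0.
  have t0 := tau0 lL'; have l0 : 0 < ls s by lra.
  split=> //=; rewrite ?refreshE//.
  + by apply: (xtilde_edom SC); rewrite /taut /sigmat !refreshE; exact: t0.
  + by apply: (ytilde_edom P SC); rewrite refreshE.
  + by rewrite le_max lexx orbT.
  + by rewrite m1.
  + have gl : gamma P * ls s <= ls s by rewrite ger_pMl// ltW.
    have : Num.max (gamma2 P * ls s) (l_init P) <= ls s.
      by rewrite ge_max l1 andbT.
    set M := Num.max _ _ => ML; have : gamma P * M <= gamma P * ls s by rewrite ler_pM2l.
    lra.
- move=> [pE lL'] _ xd yd l1 L1 m1 m2 mE lL oL Ms fr tau0.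
  split=> //=; rewrite ?refreshE//.
  + by rewrite /gamma2 ler_pdivlMr//; have : gamma P * l_init P <= l_init P;
      [rewrite ger_pMl//; lra|lra].
  + by rewrite m1.
  + by rewrite /gamma2 mulrC divfK// gt_eqF.
  + by rewrite /max_approx/= refreshE.
  + by move=> _ fl; have := fr pE fl; rewrite /fresh /max_approx /= !refreshE.
- move=> pE lL' xd yd l1 L1 m1 m2 mE lL oL Ms fr tau0.
  have L0 : 0 < Ls s by lra.
  have q0 : 0 < gamma1 P by rewrite exprn_gt0.
  (* Here [r >= 1] matters: [gamma ^ r <= gamma] lets a single enlargement restore [l_t <= L_t]. *)
  have qg : gamma1 P <= gamma P.
    by rewrite /gamma1 -(prednK r0) exprS ger_pMr// exprn_ile1 ?ltW.
  have LL : Ls s <= Ls s / gamma1 P by rewrite ler_pdivlMr// ger_pMr//; lra.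
  have lL1 : ls s <= Ls s / gamma1 P.
    rewrite ler_pdivlMr//; apply: le_trans lL; rewrite mulrC ler_pM2r//; lra.
  split=> //=; first lra.
  + rewrite lt_max mulr_gt0//= ge_max (le_trans _ m2)/=; last first.
      by rewrite ger_pMr//; lra.
    rewrite /mu_low; case: ifP => [/mk->//|_]; exact: ltW.
  + rewrite /mu_low; move: mE; case: ifP => _ E.
      by rewrite max_r// E ger_pMr//; lra.
    rewrite max_l ?mulr_ge0 ?ltW// -E mulrACA divff ?mulr1// gt_eqF//.
  + by apply: le_trans lL1; rewrite ger_pMl ?ltW//; lra.
Qed.

Lemma invariant_partial_run N (u : nat -> state) k :
  partial_run g h f mu P x0 y0 N u -> (k <= N)%N -> invariant (u k).
Proof.
move=> [ini st]; elim: k => [_|k IH kN]; first exact: invariant_initial ini.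
by apply: invariant_step (st _ kN); apply: IH; exact: ltnW.
Qed.

Lemma invariant_run (u : nat -> state) k :
  run g h f mu P x0 y0 u -> invariant (u k).
Proof.
by move=> [ini st]; apply: (@invariant_partial_run k u) => //; split=> // i _; exact: st.
Qed.

(** Only the call to the solver could block, and an exact maximizer is an admissible answer. *)
Lemma exists_step s : invariant s -> exists s', stp s s'.
Proof.
move=> I; case pE: (ph s).
  have [ms|ms] := boolP (max_solver P); last first.
    by eexists; exact: step_prox.
  have [fl|fl] := boolP (flag s); first by eexists; exact: step_keep.
  have [y [yd My]] := exists_maximizer SC (inv_x I).
  have z0 : 0 < zeta P by have [[]] := VP.
  eexists; apply: (@step_solve _ _ _ _ _ _ _ _ s y) => // w.
  rewrite (LagE SC (inv_x I) yd).
  have [wd|/notin_edom hw] := pselect (edom h w).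
    by rewrite (LagE SC (inv_x I) wd) -EFinD lee_fin; have := My w wd; lra.
  have [[gnoo _] _ _] : proper_closed_convex g by have [[]] := SC.
  by rewrite /Lag hw (fin_edom gnoo (inv_x I)) /= leNye.
have [lL|lL] := leP (ls s) (Ls s); last by eexists; exact: step_enlarge.
have [sc|sc] := boolP (succeeds s); eexists.
  exact: step_accept.
exact: step_reject.
Qed.

Definition accepts s := checks s /\ succeeds s.

Lemma step_it s s' : stp s s' ->
  it s' = it s /\ ~ accepts s \/ it s' = (it s).+1 /\ accepts s.
Proof.
case=> {}s.
- by move=> y pE *; left; split=> // -[[]]; rewrite pE.
- by move=> pE *; left; split=> // -[[]]; rewrite pE.
- by move=> pE *; left; split=> // -[[]]; rewrite pE.
- by move=> ck sc; right; rewrite /= refreshE.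
- by move=> ck sc; left; rewrite /= refreshE; split=> // -[_]; exact/negP.
- by move=> pE lL; left; split=> // -[[_]]; rewrite leNgt lL.
Qed.

Lemma step_check s s' : checks s -> ~ accepts s -> stp s s' ->
  [/\ ph s' = Inner, Ls s' = Ls s, ls s' = ls s / gamma P & flag s' = flag s].
Proof.
move=> ck na H; case: H ck na => {}s.
- by move=> y pE _ _ _ []; rewrite pE.
- by move=> pE _ _ []; rewrite pE.
- by move=> pE _ []; rewrite pE.
- by move=> ck sc _ [].
- by move=> ck sc _ _; rewrite /= !refreshE.
- by move=> pE lL [_]; rewrite leNgt lL.
Qed.

Lemma step_outer s s' : ph s = Outer -> stp s s' ->
  [/\ ph s' = Inner, Ls s' = Ls s, ls s' = ls s & flag s'].
Proof.
move=> pE H; case: H pE => {}s //.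
- by move=> [->].
- by move=> [->].
- by move=> ->.
Qed.

Lemma step_while_exit s s' : ph s = Inner -> Ls s < ls s -> stp s s' ->
  [/\ ph s' = Outer, ls s' = ls s & flag s' = flag s].
Proof.
move=> pE lL H; case: H pE lL => {}s.
- by move=> y ->.
- by move=> ->.
- by move=> ->.
- by move=> [_ +] _ _; rewrite leNgt => /negbTE->.
- by move=> [_ +] _ _; rewrite leNgt => /negbTE->.
- by [].
Qed.

(** * Contradiction from a run that stops accepting *)

Section no_acceptance.
Variables (u : nat -> state) (k0 : nat).
Hypothesis ru : run g h f mu P x0 y0 u.
Hypothesis na : forall k, (k0 <= k)%N -> ~ accepts (u k).

Let inv k : invariant (u k). Proof. exact: invariant_run ru. Qed.
Let st k : stp (u k) (u k.+1). Proof. by have [_] := ru. Qed.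

Lemma no_acceptance_step k : (k0 <= k)%N ->
  ls (u k) <= ls (u k.+1) /\ (flag (u k) -> flag (u k.+1)).
Proof.
move=> kk; have [_ _ /andP[g0 g1] _ _] := VP; have [[_ m0 ml] _ _ _ _] := VP.
have l1 := inv_l (inv k).
case pE: (ph (u k)); first by have [_ _ -> ->] := step_outer pE (st k).
have [lL|lL] := leP (ls (u k)) (Ls (u k)).
  have [|_ _ -> ->] // := step_check _ (na kk) (st k).
  by split=> //; rewrite ler_pdivlMr// ger_pMr ?ltW//; lra.
by have [_ -> ->] := step_while_exit pE lL (st k).
Qed.

Lemma no_acceptance_mono k j : (k0 <= k)%N ->
  ls (u k) <= ls (u (k + j)) /\ (flag (u k) -> flag (u (k + j))).
Proof.
move=> kk; elim: j => [|j [IHl IHf]]; first by rewrite addn0.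
rewrite addnS; have [|H1 H2] := @no_acceptance_step (k + j).
  exact: leq_trans (leq_addr _ _).
by split; [exact: le_trans H1|move=> /IHf].
Qed.

(** Leaving the while loop takes one step and re-entering it another, after which the test passes by
    [inv_outer]. *)
Lemma no_acceptance_next_check k : (k0 <= k)%N ->
  exists2 j, (j <= 2)%N & checks (u (k + j)).
Proof.
move=> kk.
have outer i : ph (u i) = Outer -> checks (u i.+1).
  move=> pE; have [p' L' l' _] := step_outer pE (st i).
  by split; rewrite // L' l'; exact: inv_outer pE.
case pE: (ph (u k)); first by exists 1%N; rewrite // addn1; exact: outer.
have [lL|lL] := leP (ls (u k)) (Ls (u k)); first by exists 0%N; rewrite // addn0.
have [p' _ _] := step_while_exit pE lL (st k).
by exists 2; rewrite // addn2; exact: outer.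
Qed.

(** Three steps contain a failed check, which divides [l_t] by [gamma]; as [l_t] is at least its
    initial value, the gain has a fixed lower bound. *)
Lemma no_acceptance_growth k : (k0 <= k)%N ->
  ls (u k) + l_init P * ((gamma P)^-1 - 1) <= ls (u (k + 3)).
Proof.
move=> kk; have [_ _ /andP[g0 g1] _ _] := VP.
have [j j2 ck] := no_acceptance_next_check kk.
have kj : (k0 <= k + j)%N by exact: leq_trans (leq_addr _ _).
have [_ _ lE _] := step_check ck (na kj) (st (k + j)).
have [lk _] := no_acceptance_mono j kk.
have [|l3 _] := @no_acceptance_mono (k + j).+1 (2 - j); first exact: leqW.
have E : ((k + j).+1 + (2 - j) = k + 3)%N by rewrite addSn -addnA subnKC// addn2 addn3.
rewrite E lE in l3.
have gi : 1 <= (gamma P)^-1 by rewrite invf_ge1// ltW.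
have := inv_l (inv (k + j)) => l1.
have : l_init P * ((gamma P)^-1 - 1) <= ls (u (k + j)) * ((gamma P)^-1 - 1).
  by rewrite ler_wpM2r// subr_ge0.
lra.
Qed.

Lemma no_acceptance_unbounded (K : R) :
  exists2 k, (k0 <= k)%N & K <= ls (u k).
Proof.
have [_ _ /andP[g0 g1] _ _] := VP; have [[_ m0 ml] _ _ _ _] := VP.
set d := l_init P * ((gamma P)^-1 - 1).
have d0 : 0 < d by rewrite mulr_gt0 ?subr_gt0 ?invf_gt1//; lra.
have grow j : d *+ j <= ls (u (k0 + 3 * j)).
  elim: j => [|j IH]; first by have := inv_l (inv (k0 + 3 * 0)); rewrite mulr0n; lra.
  have := @no_acceptance_growth (k0 + 3 * j) (leq_addr _ _).
  by rewrite -/d mulnS (addnC 3) addnA mulrSr; lra.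
have [j Kj] : exists j, K <= d *+ j.
  exists (Num.Def.archi_bound (`|K| / d)).
  have : `|K| / d < (Num.Def.archi_bound (`|K| / d))%:R.
    by apply: archi_boundP; rewrite divr_ge0// ltW.
  rewrite ltr_pdivrMr// mulrC mulr_natr => H.
  by apply: le_trans (ltW H); exact: ler_norm.
by exists (k0 + 3 * j)%N; [exact: leq_addr|exact: le_trans (grow j)].
Qed.

(* While the counter never reaches [Outer], [Ls] stays put, whereas [ls] grows
   without bound and satisfies [gamma * ls <= Ls]. *)
Lemma no_acceptance_flag : exists2 k, (k0 <= k)%N & flag (u k).
Proof.
have [_ _ /andP[g0 g1] _ _] := VP.
have [[i [ki pE]]|no] := pselect (exists i, (k0 <= i)%N /\ ph (u i) = Outer).
  by have [_ _ _ fl] := step_outer pE (st i); exists i.+1; rewrite // leqW.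
exfalso.
have inner k : (k0 <= k)%N -> ph (u k) = Inner.
  by move=> kk; case pE: (ph (u k)) => //; exfalso; apply: no; exists k.
have cst j : Ls (u (k0 + j)) = Ls (u k0).
  elim: j => [|j IH]; first by rewrite addn0.
  have kj : (k0 <= k0 + j)%N by exact: leq_addr.
  rewrite addnS -IH; have [lL|lL] := leP (ls (u (k0 + j))) (Ls (u (k0 + j))).
    by have [|_ -> _ _] // := step_check _ (na kj) (st (k0 + j)); split=> //; exact: inner.
  have [pE _ _] := step_while_exit (inner _ kj) lL (st (k0 + j)).
  by exfalso; apply: no; exists (k0 + j).+1; rewrite leqW.
have [k kk] := no_acceptance_unbounded (Ls (u k0) / gamma P + 1).
have := inv_lL (inv k); rewrite -(subnKC kk) cst -ler_pdivlMl// mulrC; lra.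
Qed.

Lemma no_acceptance_false : False.
Proof.
have [_ _ /andP[g0 g1] _ _] := VP; have [[_ m0 ml] _ _ _ _] := VP.
have [_ _ [Lf_ge0 _] [mu_gt0 _]] := SC.
(* The first two terms and the third give the two lower bounds on [l_t]; the last yields
   [mu_t <= mu] for unknown [mu], since [L_t >= l_t >= K] and [mu_t L_t] is constant. *)
set K := 2 * mu + 2 * Lf + Lf ^+ 2 / mu + mu_init P * l_init P / mu.
have [k1 kk1 fl1] := no_acceptance_flag.
have [k2 kk2 Kl2] := no_acceptance_unbounded K.
set k := maxn k1 k2.
have kk : (k0 <= k)%N by rewrite leq_max kk1.
have fl : flag (u k).
  have [_] := no_acceptance_mono (k - k1) kk1.
  by rewrite subnKC ?leq_maxl//; apply.
have Kl : K <= ls (u k).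
  have [H _] := no_acceptance_mono (k - k2) kk2.
  by move: H; rewrite subnKC ?leq_maxr//; exact: le_trans.
have [j _ ck] := no_acceptance_next_check kk.
have [lj /(_ fl) flj] := no_acceptance_mono j kk.
have kj : (k0 <= k + j)%N by exact: leq_trans (leq_addr _ _).
apply: (na kj); split=> //.
have I := inv (k + j); have [pE lL] := ck.
have [m1 m2] := andP (inv_mus I).
have q1 : 0 <= Lf ^+ 2 / mu by rewrite divr_ge0 ?sqr_ge0// ltW.
have q2 : 0 <= mu_init P * l_init P / mu by rewrite divr_ge0 ?mulr_ge0 ?ltW//; lra.
have {Kl lj} Kl := le_trans Kl lj.
apply: (BC_fresh SC VP) => //.
- exact: inv_fresh.
- exact: inv_x.
- exact: inv_y.
- have := inv_mu I; case: ifP => [_ ->//|_ E].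
  have L0 : 0 < Ls (u (k + j)) by have := inv_L I; lra.
  rewrite -(ler_pM2r L0) E -ler_pdivrMl// [_^-1 * _]mulrC.
  by move: Kl lL; rewrite /K; lra.
- by move: Kl; rewrite /K; lra.
- by rewrite mulrC -ler_pdivrMr//; move: Kl; rewrite /K; lra.
Qed.

End no_acceptance.

(** * Acceptance at every index and finiteness of the checks *)

Lemma eventually_accepts (u : nat -> state) k0 : run g h f mu P x0 y0 u ->
  exists2 k, (k0 <= k)%N & accepts (u k).
Proof.
move=> ru; apply: contrapT => no; apply: (@no_acceptance_false u k0 ru) => k kk ak.
by apply: no; exists k.
Qed.

Lemma it_mono (u : nat -> state) k j : run g h f mu P x0 y0 u ->
  (it (u k) <= it (u (k + j)))%N.
Proof.
move=> [_ st]; elim: j => [|j IH]; first by rewrite addn0.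
by rewrite addnS; apply: (leq_trans IH); case: (step_it (st (k + j))) => -[->].
Qed.

(** Induction on [t]. Up to the first acceptance after a given time the index is constant, and the
    accepting step raises it by one. *)
Lemma exists_acceptance (u : nat -> state) t : run g h f mu P x0 y0 u ->
  exists2 k, it (u k) = t & accepts (u k).
Proof.
move=> ru; have [[_ i0 _ _ _] st] := ru.
have from k0 : exists2 k, it (u k) = it (u k0) & accepts (u k).
  have ex : exists j : nat, `[< accepts (u (k0 + j)%N) >].
    have [k kk ak] := eventually_accepts k0 ru.
    by exists (k - k0)%N; rewrite subnKC//; apply/asboolP.
  case: (ex_minnP ex) => j /asboolP aj minj; exists (k0 + j)%N => //.
  have : forall i, (i <= j)%N -> it (u (k0 + i)%N) = it (u k0).
    elim=> [|i IH ij]; first by rewrite addn0.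
    rewrite addnS; case: (step_it (st (k0 + i))) => -[E A].
      by rewrite E; apply: IH; exact: ltnW.
    by have := minj i (asboolT A); rewrite leqNgt ij.
  exact.
elim: t => [|t [k it_k ak]]; first by have [k E ak] := from 0%N; exists k; rewrite ?E.
have [k' E ak'] := from k.+1; exists k' => //; rewrite E.
case: (step_it (st k)) => -[Ek A]; first by case: (A ak).
by rewrite Ek it_k.
Qed.

(** After the acceptance at time [k] the index exceeds [t] and never decreases, so every check of
    [t] occurs at a time at most [k]. *)
Lemma finite_checks (u : nat -> state) t : run g h f mu P x0 y0 u ->
  finite_set [set k | it (u k) = t /\ checks (u k)].
Proof.
move=> ru; have [k it_k ak] := exists_acceptance t ru.
apply: (@sub_finite_set _ _ `I_k.+1); last exact: finite_II.
move=> i /= [it_i _]; rewrite ltnNge; apply/negP => ki.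
have := it_mono k.+1 (i - k.+1) ru; rewrite subnKC// it_i -it_k.
have [_ st] := ru; case: (step_it (st k)) => -[-> A]; last by rewrite ltnn.
by case: (A ak).
Qed.

End runs.

(** The second conjunct expresses well-definedness: no partial run gets stuck, so the claim about
    infinite runs is not vacuous. *)
Theorem theorem3p2 (R : realType) (m n : nat)
    (g : 'rV[R]_m -> \bar R) (h : 'rV[R]_n -> \bar R)
    (f : 'rV[R]_m -> 'rV[R]_n -> R) (Lf mu : R) (P : agda_inputs R)
    (x0 : 'rV[R]_m) (y0 : 'rV[R]_n) :
  assumption_SC g h f Lf mu -> valid_inputs mu P ->
  edom g x0 -> edom h y0 ->
  (forall u, run g h f mu P x0 y0 u -> forall t : nat,
     finite_set [set k | it (u k) = t /\ checks (u k)] /\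
     exists k, [/\ it (u k) = t, checks (u k)
                 & check_succeeds g h f P (u k)]) /\
  (forall N u, partial_run g h f mu P x0 y0 N u ->
     exists s, step g h f mu P (u N) s).
Proof.
move=> SC VP x0d y0d; split=> [u ru t|N u pu].
  split; first exact: (finite_checks SC VP x0d y0d).
  by have [k itk [ck sk]] := exists_acceptance SC VP x0d y0d t ru; exists k.
exact/(exists_step SC VP)/(invariant_partial_run SC VP x0d y0d pu).
Qed.
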